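(* Suppose there exist a parameter value $\bar\theta\in\operatorname{int}\Theta$ (the interior of $\Theta$), a neighbourhood $M$ of $\bar\theta$, and a (possibly random) $\mathbb{R}^p$-valued function $G$ on $M$ such that: (i) $G_n(\bar\theta)\to 0$ in $\mathbb{P}$-probability as $n\to\infty$, and $G(\bar\theta)=0$; (ii) for $\mathbb{P}$-almost all $\omega$, $G(\cdot,\omega)$ and all $G_n(\cdot,\omega)$ are continuously differentiable on $M$, and $\sup_{\theta\in M}\|\partial_\theta G_n(\theta)-\partial_\theta G(\theta)\|\to 0$ in $\mathbb{P}$-probability; (iii) the matrix $\partial_\theta G(\bar\theta)$ is non-singular with $\mathbb{P}$-probability one. Then there exists a sequence $(\hat\theta_n)$ of $G_n$-estimators which is weakly $\bar\theta$-consistent. Moreover, this sequence is eventually unique, that is, if $(\hat\theta_n')$ is any other weakly $\bar\theta$-consistent sequence of $G_n$-estimators, then $\mathbb{P}(\hat\theta_n\neq\hat\theta_n')\to 0$ as $n\to\infty$.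
   Context: Setting: $(\Omega,\mathcal{F},\mathbb{P})$ is a complete probability space ($\mathbb{P}$ is the true measure), $\Theta\subseteq\mathbb{R}^p$ is the parameter set, and for each $n$, $\mathcal{F}_n\subseteq\mathcal{F}$ is a $\mathbb{P}$-complete sub-$\sigma$-field (generated by the observations at stage $n$). An estimating function at stage $n$ is a map $G_n:\Theta\times\Omega\to\mathbb{R}^p$ that is measurable with respect to the product of the Borel $\sigma$-field of $\Theta$ with $\mathcal{F}_n$; the argument $\omega$ is usually suppressed. $G_n$-estimators: let $\delta$ be an extra point outside $\Theta$ and $\Theta_\delta=\Theta\cup\{\delta\}$. Let $D_n$ be the set of all $\omega$ for which $G_n(\theta,\omega)=0$ for at least one $\theta\in\Theta$. A $G_n$-estimator is any $\mathcal{F}_n$-measurable map $\hat\theta_n:\Omega\to\Theta_\delta$ such that $\hat\theta_n\in\Theta$ and $G_n(\hat\theta_n)=0$ on $D_n$, and $\hat\theta_n=\delta$ on the complement of $D_n$. The metric on $\Theta_\delta$ is the Euclidean metric on $\Theta$, and the distance between $\delta$ and any point of $\Theta$ is $1$. A sequence $(\hat\theta_n)$ is weakly $\bar\theta$-consistent if $\hat\theta_n\to\bar\theta$ in $\mathbb{P}$-probability as $n\to\infty$ (in particular $\mathbb{P}(\hat\theta_n=\delta)\to 0$). $\|\cdot\|$ is the operator norm on $p\times p$ matrices (for the Euclidean norm), and $\partial_\theta G$ denotes the $p\times p$ Jacobian matrix.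
   Formalization: The parameter set Θ is assumed to be a Borel subset of R^p; for an arbitrary Θ the set D_n may fail to be F_n-measurable, and then no G_n-estimator exists. *)

(* Defs.v *)
From HB Require Import structures.
From mathcomp Require Import all_boot all_order all_algebra.
From mathcomp Require Import all_classical all_reals all_analysis.

Set Implicit Arguments.
Unset Strict Implicit.
Unset Printing Implicit Defensive.

Import Order.TTheory GRing.Theory Num.Theory.
Import numFieldNormedType.Exports.

Local Open Scope classical_set_scope.
Local Open Scope ring_scope.

(* R^p with its Borel sigma-field. *)
Definition borelRV (R : realType) (p : nat) :=
  g_sigma_algebraType (@open 'rV[R]_p).

(* The library norm `|v| on 'rV_p is the sup norm, hence this definition. *)
Definition enorm (R : realType) (p : nat) (v : 'rV[R]_p) : R :=
  Num.sqrt (\sum_(i < p) v ord0 i ^+ 2).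

(* Matrices act on row vectors from the right, as in 'D_v f x = v *m 'J f x;
   the library Jacobian is the transpose of the matrix (d f_i / d x_j)_(i, j),
   and transposition preserves this norm. *)
Definition opnorm (R : realType) (p : nat) (A : 'M[R]_p) : R :=
  sup [set enorm (v *m A) | v in [set v : 'rV[R]_p | enorm v <= 1]].

(* Continuous differentiability on M, meant for open M: both clauses involve
   f on a full neighbourhood of each point of M. *)
Definition C1_on (R : realType) (p : nat) (M : set 'rV[R]_p)
    (f : 'rV[R]_p -> 'rV[R]_p) : Prop :=
  forall x, M x ->
    differentiable f x /\ {for x, continuous (fun y => jacobian f y)}.

(* Completeness is that of the measure space (T, F, P restricted to F); it holds
   in particular when F contains every P-null set. *)
Definition complete_sub_sigma_field d (T : measurableType d) (R : realType)
    (P : probability T R) (F : set (set T)) : Prop :=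
  [/\ sigma_algebra [set: T] F,
      F `<=` (measurable : set (set T)) &
      forall A N : set T, F N -> P N = 0%E -> A `<=` N -> F A].

(* Only the values G theta w with theta in Theta matter.  For a Borel set Theta
   this is measurability on Theta * T for the product of the trace Borel
   sigma-field with F. *)
Definition estimating_function d (T : measurableType d) (R : realType)
    (p : nat) (Theta : set 'rV[R]_p) (F : set (set T))
    (G : 'rV[R]_p -> T -> 'rV[R]_p) : Prop :=
  @measurable_fun _ _ (borelRV R p * g_sigma_algebraType F)%type (borelRV R p)
    (Theta `*` [set: T]) (fun z => G z.1 z.2).

(* Theta_delta is encoded in option 'rV_p, with None for the extra point delta;
   values Some theta with theta outside Theta are not taken by estimators. *)
Definition dist_delta (R : realType) (p : nat) (x y : option 'rV[R]_p) : R :=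
  match x, y with
  | Some u, Some v => enorm (u - v)
  | None, None => 0
  | _, _ => 1
  end.

(* Since delta is an isolated point, A is a Borel set of option 'rV_p exactly
   when its trace on 'rV_p is Borel. *)
Definition measurable_delta d (T : measurableType d) (R : realType) (p : nat)
    (F : set (set T)) (h : T -> option 'rV[R]_p) : Prop :=
  forall A : set (option 'rV[R]_p),
    measurable (Some @^-1` A : set (borelRV R p)) -> F (h @^-1` A).

Definition zero_event d (T : measurableType d) (R : realType) (p : nat)
    (Theta : set 'rV[R]_p) (G : 'rV[R]_p -> T -> 'rV[R]_p) : set T :=
  [set w | exists2 theta, Theta theta & G theta w = 0].

Definition estimator d (T : measurableType d) (R : realType) (p : nat)
    (Theta : set 'rV[R]_p) (F : set (set T)) (G : 'rV[R]_p -> T -> 'rV[R]_p)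
    (h : T -> option 'rV[R]_p) : Prop :=
  [/\ measurable_delta F h,
      forall w, zero_event Theta G w ->
        exists theta, [/\ h w = Some theta, Theta theta & G theta w = 0] &
      forall w, ~ zero_event Theta G w -> h w = None].

(* Convergence to 0 in probability of nonnegative, possibly infinite X n. *)
Definition cvg_prob0 d (T : measurableType d) (R : realType)
    (P : probability T R) (X : nat -> T -> \bar R) : Prop :=
  forall eps : R, 0 < eps ->
    P [set w | (eps%:E < X n w)%E] @[n --> \oo] --> (0%E : \bar R).

Definition weakly_consistent d (T : measurableType d) (R : realType) (p : nat)
    (P : probability T R) (thetabar : 'rV[R]_p)
    (h : nat -> T -> option 'rV[R]_p) : Prop :=
  cvg_prob0 P (fun n w => (dist_delta (h n w) (Some thetabar))%:E).

(* Main.v *)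
(** With probability close to 1 the Jacobian of [Gn] stays, on a fixed small
    ball around [thetabar], so close to the invertible Jacobian of [G] at
    [thetabar] that [Gn] is injective there and, when [Gn thetabar] is small enough, has a
    zero near [thetabar] by the contraction principle.  All the events
    involved are measurable because suprema of continuous functions may be
    taken over a countable dense set.

    An estimator must select a zero measurably for every outcome, including
    those where [Gn] has no regularity, which calls for the measurable
    selection theorem.  Coding points of [R^p] by the integer sequences that
    index approximations in a dense sequence, a product-measurable set becomes
    a Suslin scheme of measurable sets; hulls of the branches of the scheme are
    exact up to null sets, so completeness makes the projection measurable, and
    following leftmost branches gives the selection.  Applying this to the
    zeros in shrinking balls around [thetabar] makes the estimator consistent. *)

Require Import Defs.
From HB Require Import structures.
From mathcomp Require Import all_boot all_order all_algebra.
From mathcomp Require Import all_classical all_reals all_analysis.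
From mathcomp Require Import measurable_realfun zify ring lra.

Set Implicit Arguments.
Unset Strict Implicit.
Unset Printing Implicit Defensive.

Import Order.TTheory GRing.Theory Num.Theory.
Import numFieldNormedType.Exports.

Local Open Scope classical_set_scope.
Local Open Scope ring_scope.

Lemma natSinv_lt (R : realType) (e : R) : 0 < e -> exists n : nat, n.+1%:R^-1 < e.
Proof.
move=> e0; have [n _ /(_ _ (leqnn n))] := near_infty_natSinv_lt (PosNum e0).
by exists n.
Qed.

(** * Suslin schemes over a complete measure *)

Section suslin.
Context d (T : measurableType d) (R : realType).
Variable (mu : {measure set T -> \bar R}).
Hypothesis mu_fin : (mu [set: T] < +oo)%E.

Lemma measure_fin_num (A : set T) : measurable A -> mu A \is a fin_num.
Proof.
move=> mA; rewrite ge0_fin_numE//; apply: le_lt_trans mu_fin.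
by apply: le_measure; rewrite ?inE//; exact: measurableT.
Qed.

(** Intersecting measurable supersets of nearly least measure yields one of least measure. If [C] is
    another, then so is the intersection with [C], whose measure cannot drop, so the part outside
    [C] is null. [E] itself may be non-measurable. *)
Lemma measurable_hull (E : set T) : exists2 B : set T,
  measurable B /\ E `<=` B &
  forall C, measurable C -> E `<=` C -> mu (B `\` C) = 0%E.
Proof.
pose S := [set mu B | B in [set B | measurable B /\ E `<=` B]].
have S0 : lbound S 0%E by move=> _ [B _ <-].
have Sfin : ereal_inf S \is a fin_num.
  rewrite ge0_fin_numE; last by apply: le_ereal_inf_tmp.
  by apply: le_lt_trans mu_fin; apply: ereal_inf_lbound; exists setT.
have pickB n : {B : set T | [/\ measurable B, E `<=` B &
    (mu B < ereal_inf S + (n.+1%:R^-1)%:E)%E]}.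
  apply: cid; have n0 : (0 < n.+1%:R^-1 :> R) by rewrite invr_gt0 ltr0n.
  by have [_ [B [mB EB] <-] ltB] := lb_ereal_inf_adherent n0 Sfin; exists B.
pose B n := projT1 (pickB n).
have mB n : measurable (B n) by rewrite /B; case: (pickB n) => ? [].
have EB n : E `<=` B n by rewrite /B; case: (pickB n) => ? [].
have ltB n : (mu (B n) < ereal_inf S + (n.+1%:R^-1)%:E)%E.
  by rewrite /B; case: (pickB n) => ? [].
have mcapB : measurable (\bigcap_n B n) by exact: bigcapT_measurable.
exists (\bigcap_n B n).
  by split=> // x Ex n _; exact: EB.
move=> C mC EC.
have le_inf : (mu (\bigcap_n B n) <= ereal_inf S)%E.
  apply/lee_addgt0Pr => e e0.
  have [n ne] := natSinv_lt e0.
  apply: (@le_trans _ _ (mu (B n))).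
    by apply: le_measure; rewrite ?inE// => x; exact.
  by apply: (le_trans (ltW (ltB n))); rewrite leeD2l// lee_fin ltW.
have mcapC : measurable ((\bigcap_n B n) `&` C) by exact: measurableI.
have inf_le : (ereal_inf S <= mu ((\bigcap_n B n) `&` C))%E.
  apply: ereal_inf_lbound; exists ((\bigcap_n B n) `&` C) => //.
  split=> // x Ex; split; [by move=> n _; exact: EB|exact: EC].
rewrite measureD//; last by rewrite -ge0_fin_numE// measure_fin_num.
apply/eqP; rewrite eq_le; apply/andP; split.
  rewrite sube_le0; exact: le_trans inf_le.
rewrite sube_ge0; last by rewrite measure_fin_num.
by apply: le_measure; rewrite ?inE// => x [].
Qed.


Hypothesis mu_complete : measure_is_complete mu.

(** Suslin's operation restricted to the branches through the node [s]; the root [[::]] gives the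
    full operation. *)
Definition suslin (B : seq nat -> set T) (s : seq nat) : set T :=
  [set w | exists sigma, mkseq sigma (size s) = s /\
                         forall n, B (mkseq sigma n) w].

Lemma take_mkseq (I : Type) (f : nat -> I) (m n : nat) :
  (m <= n)%N -> take m (mkseq f n) = mkseq f m.
Proof. by move=> mn; rewrite /mkseq -map_take take_iota (minn_idPl mn). Qed.

Lemma suslin_rcons (B : seq nat -> set T) (s : seq nat) :
  suslin B s = \bigcup_i suslin B (rcons s i).
Proof.
apply/seteqP; split=> [w [f [fs fB]]|w [i _ [f [fs fB]]]].
  by exists (f (size s)) => //; exists f; rewrite size_rcons mkseqS fs.
exists f; split=> //; move: fs; rewrite size_rcons mkseqS => /rcons_inj[].
by [].
Qed.

Lemma suslin_sub (B : seq nat -> set T) (s : seq nat) : suslin B s `<=` B s.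
Proof. by move=> w [f [<- fB]]; exact: fB. Qed.

Lemma bigcup_seq_measurable (F : seq nat -> set T) :
  (forall s, measurable (F s)) -> measurable (\bigcup_s F s).
Proof. by move=> mF; apply: countable_bigcupT_measurable. Qed.

(* [H s] is a measurable hull of [suslin B s]. Each [H s] is covered, up to a
   null set, by the hulls of the successors of [s], so that outside one null
   set every point of [H s] can be followed along an infinite branch. *)
Lemma measurable_suslin (B : seq nat -> set T) (s : seq nat) :
  (forall s, measurable (B s)) -> measurable (suslin B s).
Proof.
move=> mB.
pose C s := \bigcap_(n in [set n | (n <= size s)%N]) B (take n s).
have mC t : measurable (C t) by exact: bigcap_measurableType.
have subC t : suslin B t `<=` C t.
  by move=> w [f [<- fB]] n /=; rewrite size_mkseq => nt; rewrite take_mkseq.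
pose H0 t := projT1 (cid2 (measurable_hull (suslin B t))).
have mH0 t : measurable (H0 t) by rewrite /H0; case: cid2 => ? [].
have H0sub t : suslin B t `<=` H0 t by rewrite /H0; case: cid2 => ? [].
have H0min t D : measurable D -> suslin B t `<=` D -> mu (H0 t `\` D) = 0%E.
  by rewrite /H0; case: cid2 => ? [] ? ? /= h; exact: h.
(* Cutting the hull down by [C t] costs nothing, since [suslin B t] lies in [C t], and ensures that
   a point followed along a branch through the [H t] lies in every [B] on it. *)
pose H t := H0 t `&` C t.
have mH t : measurable (H t) by exact: measurableI.
have subH t : suslin B t `<=` H t by move=> w tw; split; [exact: H0sub|exact: subC].
pose N t := H t `\` \bigcup_i H (rcons t i).
have mHU t : measurable (\bigcup_i H (rcons t i)) by exact: bigcupT_measurable.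
have mN t : measurable (N t) by exact: measurableD.
have N0 t : mu (N t) = 0%E.
  (* The union of the successor hulls is a measurable superset of [suslin B t], so minimality of
     [H0 t] makes the difference null. *)
  apply: (@subset_measure0 _ _ _ _ _ (H0 t `\` \bigcup_i H (rcons t i))) => //.
  - exact: measurableD.
  - by move=> w [[]].
  - apply: H0min => // w; rewrite suslin_rcons => -[i _ iw].
    by exists i => //; exact: subH.
pose NF k := if unpickle k is Some t then N t else set0.
pose NN := \bigcup_k NF k.
have NN0 : mu.-negligible NN.
  apply: negligible_bigcup => k; rewrite /NF.
  case: unpickle => [t|]; last exact: negligible_set0.
  by exists (N t); split; [exact: mN|exact: N0|].
have key : H s `\` NN `<=` suslin B s.
  move=> w [Hsw NNw].
  have step t : exists i, H t w -> H (rcons t i) w.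
    have [tw|] := pselect (H t w); last by exists 0%N.
    apply: contrapT => /forallNP Hn; apply: NNw; exists (pickle t) => //.
    rewrite /NF pickleK; split=> // -[i _ iw]; apply: (Hn i) => _; exact: iw.
  have [nxt nxtP] := choice step.
  pose g n := iter n (fun t => rcons t (nxt t)) s.
  have Hg n : H (g n) w by elim: n => //= n IH; exact: nxtP.
  have sg n : size (g n) = (size s + n)%N.
    by elim: n => [|n IH]; rewrite ?addn0//= size_rcons -/(g n) IH addnS.
  have ng m a b : (a <= b)%N -> (m < size (g a))%N ->
      nth 0%N (g b) m = nth 0%N (g a) m.
    move=> ab ma; rewrite -(subnK ab); elim: (b - a)%N => [//|k IH].
    rewrite addSn /= nth_rcons -/(g _) sg.
    by rewrite (leq_trans ma) // sg; lia.
  (* [g m.+1] has more than [m] entries and later nodes keep them, so the default 0 is never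
     read. *)
  pose f m := nth 0%N (g m.+1) m.
  have fg n : mkseq f (size s + n) = g n.
    apply: (@eq_from_nth _ 0%N); rewrite size_mkseq ?sg// => m mn.
    rewrite nth_mkseq// /f.
    case: (leqP m.+1 n) => [le|/ltnW le].
      by rewrite -(ng _ _ _ le)// sg; lia.
    by rewrite (ng _ _ _ le)// sg.
  exists f; split.
    by rewrite -[X in mkseq _ X]addn0 fg.
  move=> n; have [_ /(_ n)] := Hg n.
  by rewrite /= sg -fg => /(_ (leq_addl _ _)); rewrite take_mkseq// leq_addl.
(* The set removed from the hull lies in the null set [NN], hence is measurable by completeness. *)
have -> : suslin B s = H s `\` (H s `\` suslin B s).
  by rewrite setDD; apply/seteqP; split=> [w sw|w []//]; split=> //; exact: subH.
apply: measurableD => //; apply: mu_complete; apply: negligibleS NN0.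
by move=> w [Hw nw]; apply: contrapT => nN; apply: nw; exact: key.
Qed.

(** The leftmost branch is a measurable choice: each entry is the least one whose node still has [w]
    in its Suslin set, and these sets are measurable by [measurable_suslin]. *)
Lemma suslin_selection (B : seq nat -> set T) :
  (forall s, measurable (B s)) ->
  exists h : T -> nat -> nat,
    (forall m i, measurable [set w | h w m = i]) /\
    (forall w, suslin B [::] w -> forall n, B (mkseq (h w) n) w).
Proof.
move=> mB; pose S := suslin B.
have mS t : measurable (S t) by exact: measurable_suslin.
pose pick w t : nat :=
  if pselect (exists k, `[< S (rcons t k) w >]) is left e then ex_minn e else 0%N.
have pickP w t : S t w -> S (rcons t (pick w t)) w.
  rewrite {1}/S suslin_rcons => -[k _ kw]; rewrite /pick.
  case: pselect => [e|]; last by case; exists k; exact/asboolP.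
  by case: ex_minnP => m /asboolP.
(* Being least means membership at [k] and at no smaller index. The value 0 also arises as the
   default when no successor contains [w], hence the extra set for [k = 0]. *)
have mpick t k : measurable [set w | pick w t = k].
  have -> : [set w | pick w t = k] =
      (S (rcons t k) `\` \bigcup_(j in [set j | (j < k)%N]) S (rcons t j)) `|`
      (if k == 0%N then ~` (\bigcup_j S (rcons t j)) else set0).
    apply/seteqP; split=> w /=; rewrite /pick.
      case: pselect => [e|ne].
        case: ex_minnP => m /asboolP mw mmin; move=> <-; left; split=> // -[j /= jm jw].
        by move: jm; rewrite ltnNge mmin//; exact/asboolP.
      move=> <-; right; rewrite eqxx => -[j _ jw]; apply: ne; exists j.
      exact/asboolP.
    case=> [[kw kmin]|].
      case: pselect => [e|]; last by case; exists k; exact/asboolP.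
      case: ex_minnP => m /asboolP mw mmin.
      have : (m <= k)%N by apply: mmin; exact/asboolP.
      rewrite leq_eqVlt => /orP[/eqP//|mk]; exfalso; apply: kmin.
      by exists m.
    case: eqP => [->|//] nw; case: pselect => // e; exfalso; apply: nw.
    by case: e => j /asboolP jw; exists j.
  apply: measurableU; last first.
    by case: ifP => // _; apply: measurableC; exact: bigcupT_measurable.
  by apply: measurableD => //; apply: bigcup_measurable.
pose g w n := iter n (fun t => rcons t (pick w t)) [::].
have mg n t : measurable [set w | g w n = t].
  elim: n t => [|n IH] t; rewrite /g /=.
    have [<-|nt] := pselect ([::] = t).
      by rewrite (_ : [set _ | _] = setT)//; apply/seteqP; split.
    by rewrite (_ : [set _ | _] = set0)//; apply/seteqP; split.
  case/lastP: t => [|t k].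
    rewrite (_ : [set _ | _] = set0)//; apply/seteqP; split=> // w /=.
    by move=> /(congr1 size); rewrite size_rcons.
  have -> : [set w | rcons (g w n) (pick w (g w n)) = rcons t k] =
      [set w | g w n = t] `&` [set w | pick w t = k].
    apply/seteqP; split=> w /=; first by case/rcons_inj=> <- <-.
    by case=> -> ->.
  exact: measurableI.
exists (fun w m => pick w (g w m)); split.
  move=> m i; have -> : [set w | pick w (g w m) = i] =
      \bigcup_t ([set w | g w m = t] `&` [set w | pick w t = i]).
    apply/seteqP; split=> w /=; first by exists (g w m).
    by move=> [t _ /= [-> ->]].
  by apply: bigcup_seq_measurable => t; exact: measurableI.
move=> w Sw n.
have -> : mkseq (fun m => pick w (g w m)) n = g w n.
  by elim: n => [//|n IH]; rewrite mkseqS IH.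
apply: suslin_sub; elim: n => // n IH; exact: pickP.
Qed.

End suslin.

(** * Coding by integer sequences *)

Lemma dense_sequence (R : realType) (m n : nat) :
  exists q : nat -> 'M[R]_(m, n), forall x e, 0 < e -> exists k, `|q k - x| < e.
Proof.
pose q k : 'M[R]_(m, n) := if unpickle k is Some v
  then map_mx ratr (v : 'M[rat]_(m, n)) else 0.
exists q => x e e0.
have pickv i j : {r : rat | `|ratr r - x i j| < e}.
  apply: cid; have ne : ball (x i j) e !=set0.
    by exists (x i j); exact: ballxx.
  have [y [xy [r _ ry]]] := dense_rat ne (ball_open (x i j) e).
  by exists r; rewrite ry distrC; exact: xy.
pose v : 'M[rat]_(m, n) := \matrix_(i, j) projT1 (pickv i j).
exists (pickle v); rewrite /q pickleK distrC.
suff : ball x e (map_mx ratr v : 'M[R]_(m, n)) by rewrite -ball_normE.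
split=> // i j; rewrite !mxE /ball /= distrC.
by case: (pickv i j).
Qed.

Section interleave.

(** Packs a pair of sequences into one, so that a single Suslin branch can carry both the code of a
    point and a witness. *)
Definition interleave (rho sigma : nat -> nat) (k : nat) : nat :=
  if odd k then sigma k./2 else rho k./2.

Lemma interleave_even rho sigma : (fun k => interleave rho sigma k.*2) = rho.
Proof. by apply/funext => k; rewrite /interleave odd_double doubleK. Qed.

Lemma interleave_odd rho sigma : (fun k => interleave rho sigma k.*2.+1) = sigma.
Proof.
by apply/funext => k; rewrite /interleave /= odd_double /= uphalf_double.
Qed.

End interleave.

Definition eq_upto (m : nat) (s s' : nat -> nat) : Prop :=
  forall j, (j < m)%N -> s' j = s j.

(** Continuity on the Baire space of integer sequences for the discrete topology on [X]. *)
Definition locally_constant (X : Type) (f : (nat -> nat) -> X) : Prop :=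
  forall s, exists m, forall s', eq_upto m s s' -> f s' = f s.

Section local_suslin.
Context d (T : measurableType d) (R : realType).
Variable (mu : {measure set T -> \bar R}).
Hypothesis mu_fin : (mu [set: T] < +oo)%E.
Hypothesis mu_complete : measure_is_complete mu.

Lemma measurable_prop (Q : Prop) : measurable [set _ : T | Q].
Proof.
have [q|nq] := pselect Q.
  by rewrite (_ : [set _ | _] = setT)//; apply/seteqP; split.
by rewrite (_ : [set _ | _] = set0)//; apply/seteqP; split.
Qed.

(** Conditions that each depend on finitely many entries of [s] form a Suslin scheme: a node [t]
    imposes those conditions that [t] already decides, and every condition is decided at some finite
    stage of each branch. *)
Lemma local_suslin_selection (L : nat -> (nat -> nat) -> set T) :
  (forall n, locally_constant (L n)) -> (forall n s, measurable (L n s)) ->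
  measurable [set w | exists s, forall n, L n s w] /\
  exists h : T -> nat -> nat,
    (forall m i, measurable [set w | h w m = i]) /\
    (forall w, (exists s, forall n, L n s w) -> forall n, L n (h w) w).
Proof.
move=> Lloc mL.
pose cyl (t : seq nat) s := mkseq s (size t) = t.
(* [nth 0%N t] pads [t] with zeros; it serves as a representative of the cylinder of [t], on which
   the condition is constant. *)
pose B (t : seq nat) := \bigcap_n (if
  `[< forall s s', cyl t s -> cyl t s' -> L n s = L n s' >] then
    L n (nth 0%N t) else setT).
have mB t : measurable (B t).
  by apply: bigcapT_measurable => n; case: ifP.
have LB s w : (forall n, L n s w) <-> (forall m, B (mkseq s m) w).
  have cs m : cyl (mkseq s m) s by rewrite /cyl size_mkseq.
  have cn m : cyl (mkseq s m) (nth 0%N (mkseq s m)) by exact: mkseq_nth.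
  split=> [Ls m n _|Bs n].
    by case: asboolP => // h; rewrite (h _ s).
  have [m hm] := Lloc n s.
  have hm' s' : cyl (mkseq s m) s' -> L n s' = L n s.
    rewrite /cyl size_mkseq => ss'; apply: hm => j jm.
    by move/(congr1 (fun t => nth 0%N t j)): ss'; rewrite !nth_mkseq.
  have := Bs m n I; case: asboolP => [h|[]].
    by rewrite (h _ s).
  by move=> s1 s2 c1 c2; rewrite !hm'.
have -> : [set w | exists s, forall n, L n s w] = suslin B [::].
  apply/seteqP; split=> w.
    by move=> [s /LB sw]; exists s.
  by move=> [s [_ sw]]; exists s; exact/LB.
split; first exact: (measurable_suslin mu_fin mu_complete).
have [h [mh hB]] := suslin_selection mu_fin mu_complete mB.
exists h; split=> // w [s /LB sw]; apply/LB; apply: hB.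
by exists s.
Qed.

End local_suslin.

(** * Measurable selection *)

Section selection.
Context (R : realType) (p : nat) d (T : measurableType d).
Variable q : nat -> 'rV[R]_p.
Hypothesis q_dense : forall x e, 0 < e -> exists k, `|q k - x| < e.

Definition encodes (rho : nat -> nat) (x : 'rV[R]_p) : Prop :=
  forall m, `|q (rho m) - x| <= m.+1%:R^-1.

Lemma encodes_exists x : exists rho, encodes rho x.
Proof.
have h m : {k : nat | `|q k - x| < m.+1%:R^-1}.
  by apply: cid; apply: q_dense; rewrite invr_gt0 ltr0n.
by exists (fun m => projT1 (h m)) => m; case: (h m) => k /= /ltW.
Qed.

(** Being the code of some point becomes countably many conditions on two entries each, hence
    locally constant ones. By completeness the coded sequence converges, and the non-strict bounds
    survive in the limit. *)
Lemma encodes_cauchy rho :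
  (exists x, encodes rho x) <->
  forall m k, `|q (rho m) - q (rho k)| <= m.+1%:R^-1 + k.+1%:R^-1.
Proof.
split=> [[x xr] m k|qc].
  rewrite (_ : _ - _ = (q (rho m) - x) - (q (rho k) - x)); last first.
    by rewrite opprB addrA subrK.
  by rewrite (le_trans (ler_normB _ _))// lerD.
pose u : nat -> 'rV[R]_p := fun m => q (rho m).
have cu : cvgn u.
  apply: cauchy_cvg; apply: cauchy_exP => e e0.
  have [m me] : exists m : nat, m.+1%:R^-1 < e / 2 by apply: natSinv_lt; rewrite divr_gt0.
  exists (u m); exists m => //= k mk; rewrite -ball_normE /=.
  apply: le_lt_trans (qc m k) _.
  rewrite (splitr e) ltrD// (le_lt_trans _ me)//.
  by rewrite lef_pV2 ?posrE// ler_nat ltnS.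
exists (limn u) => m; apply/ler_addgt0Pr => e e0.
have e20 : 0 < e / 2 by rewrite divr_gt0.
have [k0 k0e] := natSinv_lt e20.
move/cvgrPdist_lt : cu => /(_ _ e20)[N _ Nu].
have [k [k0k Nk]] : exists k, (k0 <= k /\ N <= k)%N.
  by exists (maxn k0 N); rewrite leq_maxl leq_maxr.
rewrite (_ : _ - _ = (u m - u k) - (limn u - u k)); last first.
  by rewrite opprB addrA subrK.
apply: le_trans (ler_normB _ _) _.
apply: le_trans (lerD (qc m k) (ltW (Nu _ Nk))) _.
rewrite -addrA lerD2l [leRHS]splitr lerD2r (le_trans _ (ltW k0e))//.
by rewrite lef_pV2 ?posrE// ler_nat ltnS.
Qed.

(* Suslin representation of a subset of [rV * T], with the points of [rV]
   replaced by their codes. *)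
Definition analytic (A : set ('rV[R]_p * T)) : Prop :=
  exists B : nat -> (nat -> nat) -> (nat -> nat) -> set T,
    [/\ forall n, locally_constant
          (fun s => B n (fun k => s k.*2) (fun k => s k.*2.+1)),
        forall n rho sigma, measurable (B n rho sigma) &
        forall rho x w, encodes rho x ->
          (A (x, w) <-> exists sigma, forall n, B n rho sigma w)].

(** One witness stores a witness for every [A i], the one for [i] being the row [sub i] under the
    pairing [pickle (i, j)]. *)
Lemma analytic_bigcap (A : nat -> set ('rV[R]_p * T)) :
  (forall i, analytic (A i)) -> analytic (\bigcap_i A i).
Proof.
move=> /choice[B BP].
pose sub (i : nat) (s : nat -> nat) (j : nat) : nat := s (pickle (i, j)).
exists (fun k rho sigma => if unpickle k is Some (i, n) then
   B i n rho (sub i sigma) else setT); split.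
- move=> k s /=; case: unpickle => [[i n]|]; last by exists 0%N.
  have [/(_ n) loc _ _] := BP i.
  pose s1 := interleave (fun k => s k.*2) (sub i (fun k => s k.*2.+1)).
  have [m hm] := loc s1.
  (* The first summand covers the entries of the point code; the second covers the odd positions
     where the first [m] entries of row [i] are stored. *)
  exists (m.*2 + (\max_(j < m) pickle (i, j : nat)).*2.+2)%N => s' ss'.
  pose s2 := interleave (fun k => s' k.*2) (sub i (fun k => s' k.*2.+1)).
  have /hm : eq_upto m s1 s2.
    move=> j jm; rewrite /s1 /s2 /interleave /sub; case: ifP => _.
      apply: ss'; have j2m : (j./2 < m)%N by lia.
      have := @leq_bigmax _ (fun j : 'I_m => pickle (i, j : nat)) (Ordinal j2m).
      by rewrite /=; lia.
    by apply: ss'; lia.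
  by rewrite /s1 /s2 !interleave_even !interleave_odd.
- move=> k rho sigma; case: unpickle => [[i n]|]; last exact: measurableT.
  by have [_ + _] := BP i; exact.
- move=> rho x w xr; split=> [Aw|[sigma sB] i _].
    have h i : exists sigma, forall n, B i n rho sigma w.
      have [_ _ /(_ rho x w xr) [+ _]] := BP i; apply; exact: Aw.
    have [f fP] := choice h.
    exists (fun k => if unpickle k is Some (i, j) then f i j else 0%N) => k.
    case: unpickle => [[i n]|//].
    rewrite (_ : sub i _ = f i)//.
    by apply/funext => j; rewrite /sub pickleK.
  have [_ _ /(_ rho x w xr) [_ +]] := BP i; apply.
  by exists (sub i sigma) => n; have := sB (pickle (i, n)); rewrite pickleK.
Qed.

(** The first entry of the witness names the set of the union, and its tail is a witness for that
    set. *)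
Lemma analytic_bigcup (A : nat -> set ('rV[R]_p * T)) :
  (forall i, analytic (A i)) -> analytic (\bigcup_i A i).
Proof.
move=> /choice[B BP].
pose tl (s : nat -> nat) j := s j.+1.
exists (fun n rho sigma => B (sigma 0%N) n rho (tl sigma)); split.
- move=> n s /=; have [/(_ n) loc _ _] := BP (s 1%N).
  pose s1 := interleave (fun k => s k.*2) (tl (fun k => s k.*2.+1)).
  have [m hm] := loc s1.
  (* The tail shifts positions by two, and position 1, which holds the chosen index, must be covered
     even for [m = 0]. *)
  exists (m.*2.+4)%N => s' ss'.
  pose s2 := interleave (fun k => s' k.*2) (tl (fun k => s' k.*2.+1)).
  rewrite [s' _]ss'//; have /hm : eq_upto m s1 s2.
    move=> j jm; rewrite /s1 /s2 /interleave /tl; case: ifP => _.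
      by apply: ss'; lia.
    by apply: ss'; lia.
  by rewrite /s1 /s2 !interleave_even !interleave_odd.
- by move=> n rho sigma; have [_ + _] := BP (sigma 0%N); exact.
- move=> rho x w xr; split=> [[i _ Aw]|[sigma sB]].
    have [_ _ /(_ rho x w xr) [/(_ Aw)[sigma sP] _]] := BP i.
    by exists (fun k => if k is j.+1 then sigma j else i).
  exists (sigma 0%N) => //.
  have [_ _ /(_ rho x w xr) [_ +]] := BP (sigma 0%N); apply.
  by exists (tl sigma).
Qed.

Lemma analytic_snd (B : set T) : measurable B -> analytic (snd @^-1` B).
Proof.
move=> mB; exists (fun _ _ _ => B); split=> //; first by exists 0%N.
by move=> rho x w _; split=> [Bw|[s /(_ 0%N)]//]; exists id.
Qed.

Definition ball_inside (U : set 'rV[R]_p) (k m : nat) : Prop :=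
  forall y, `|q k - y| <= m.+1%:R^-1 -> U y.

(** Membership in an open set is confirmed by one entry of the code. Hence the set needs only the
    position of that entry as witness, and its complement is a countable intersection of conditions
    without witness. *)
Lemma open_encodes U rho x : open U -> encodes rho x ->
  U x <-> exists m, ball_inside U (rho m) m.
Proof.
move=> oU xr; split=> [Ux|[m]]; last by apply; exact: xr.
have /nbhs_ballP[e /= e0 eU] := open_nbhs_nbhs (conj oU Ux).
have [m me] : exists m : nat, m.+1%:R^-1 < e / 2 by apply: natSinv_lt; rewrite divr_gt0.
exists m => y qy; apply: eU; rewrite -ball_normE /=.
rewrite (_ : x - y = (q (rho m) - y) - (q (rho m) - x)); last first.
  by rewrite opprB [RHS]addrC addrA subrK.
apply: le_lt_trans (ler_normB _ _) _.
by rewrite (splitr e) ltrD// (le_lt_trans _ me)//; exact: xr.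
Qed.

Lemma analytic_open U : open U -> analytic (fst @^-1` U).
Proof.
move=> oU; exists (fun _ rho s => [set _ | ball_inside U (rho (s 0%N)) (s 0%N)]).
split.
- move=> n s; exists (maxn 2 (s 1%N).*2.+1) => s' ss'.
  by rewrite /= (ss' 1%N) ?(ss' (s 1%N).*2)//; lia.
- by move=> n rho s; exact: measurable_prop.
- move=> rho x w xr; rewrite /= (open_encodes oU xr); split.
    by move=> [m mU]; exists (fun=> m).
  by move=> [s /(_ 0%N)]; exists (s 0%N).
Qed.

Lemma analytic_openC U : open U -> analytic (~` (fst @^-1` U)).
Proof.
move=> oU; exists (fun n rho s => [set _ | ~ ball_inside U (rho n) n]).
split.
- move=> n s; exists n.*2.+1 => s' ss'.
  by rewrite /= ss'//; lia.
- by move=> n rho s; exact: measurable_prop.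
- move=> rho x w xr; rewrite /= (open_encodes oU xr); split.
    by move=> /forallNP nU; exists id.
  by move=> [s sU] [m]; exact: sU.
Qed.

(** Analytic sets are not closed under complement, but those whose complement is also analytic form
    a sigma-algebra, and it contains the generators of the product sigma-field. *)
Lemma analytic_measurable (A : set (borelRV R p * T)) :
  measurable A -> analytic A.
Proof.
pose C := [set A : set ('rV[R]_p * T) | analytic A /\ analytic (~` A)].
have sC : sigma_algebra [set: 'rV[R]_p * T] C.
  have aT : analytic setT by rewrite -(preimage_setT snd); exact: analytic_snd.
  have a0 : analytic set0 by rewrite -(preimage_set0 snd); exact: analytic_snd.
  split.
  - by split=> //; rewrite setC0.
  - by move=> B [? ?]; rewrite setTD; split=> //; rewrite setCK.
  - move=> F FC; split; first by apply: analytic_bigcup => i; have [] := FC i.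
    by rewrite setC_bigcup; apply: analytic_bigcap => i; have [] := FC i.
suff : (measurable : set (set (borelRV R p * T))) `<=` C by move=> h /h[].
apply: smallest_sub => //; rewrite subUset; split.
  move=> _ [B mB <-]; rewrite setTI.
  suff : (measurable : set (set (borelRV R p))) `<=`
    [set B | C (fst @^-1` B)] by apply.
  apply: smallest_sub.
    split.
    - by rewrite /= preimage_set0; case: sC.
    - move=> D /= CD; rewrite setTD -preimage_setC -setTD; by case: sC => _ + _; exact.
    - by move=> F FC /=; rewrite preimage_bigcup; case: sC => _ _; exact.
  by move=> U oU; split; [exact: analytic_open|exact: analytic_openC].
move=> _ [B mB <-]; rewrite setTI; split; first exact: analytic_snd.
by rewrite preimage_setC; apply: analytic_snd; exact: measurableC.
Qed.

End selection.

(** The even entries of a branch code a point [y] and the odd ones witness that [(y, w)] lies in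
    [A]. A measurable choice of branch decodes to a measurable choice of point, and the set of [w]
    having a branch is the projection of [A]. *)
Lemma measurable_selection (R : realType) (p : nat) d (T : measurableType d)
    (mu : {measure set T -> \bar R}) :
  (mu [set: T] < +oo)%E -> measure_is_complete mu ->
  forall A : set (borelRV R p * T), measurable A ->
  exists (D : set T) (x : T -> borelRV R p),
    [/\ measurable D, measurable_fun D x,
        forall w, D w <-> exists y, A (y, w) &
        forall w, D w -> A (x w, w)].
Proof.
move=> mu_fin mu_complete A mA.
have [q q_dense] := dense_sequence R 1 p.
have [B [Bloc mB BA]] := analytic_measurable q mA.
pose rho (s : nat -> nat) k := s k.*2.
pose sigma (s : nat -> nat) k := s k.*2.+1.
(* The Cauchy bounds among the first entries; all [Q n s] together say that the even entries of [s]
   code a point. *)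
pose Q n s := forall m k, (m <= n)%N -> (k <= n)%N ->
  `|q (rho s m) - q (rho s k)| <= m.+1%:R^-1 + k.+1%:R^-1.
pose L n s := B n (rho s) (sigma s) `&` [set _ | Q n s].
have Lloc n : locally_constant (L n).
  move=> s; have [m hm] := Bloc n s; exists (maxn m n.*2.+1) => s' ss'.
  rewrite /L [B n _ _]hm; last by move=> j jm; apply: ss'; rewrite leq_max jm.
  congr (_ `&` _); apply/seteqP; split=> w /= sQ i k im kn; have := sQ i k im kn.
    by rewrite /rho !ss'//; lia.
  by rewrite /rho !ss'//; lia.
have mL n s : measurable (L n s) by apply: measurableI => //; exact: measurable_prop.
have [mD [h [mh hL]]] := local_suslin_selection mu_fin mu_complete Lloc mL.
set D := [set w | _] in mD.
have Dcode w : D w -> exists y : 'rV[R]_p, encodes q (rho (h w)) y.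
  move=> Dw; apply/encodes_cauchy => m k.
  have [_ /=] := hL w Dw (maxn m k); apply; [exact: leq_maxl|exact: leq_maxr].
have codeA w y : D w -> encodes q (rho (h w)) y -> A (y, w).
  move=> Dw yw; apply/(BA _ _ _ yw); exists (sigma (h w)) => n.
  by have [] := hL w Dw n.
pose x w : borelRV R p :=
  if pselect (exists y, encodes q (rho (h w)) y) is left e then projT1 (cid e)
  else (0 : 'rV[R]_p).
have xcode w : D w -> encodes q (rho (h w)) (x w).
  move=> /Dcode e; rewrite /x; case: pselect => // e'; exact: projT2 (cid e').
exists D, x; split => //.
- apply: (measurability (@open 'rV[R]_p) (f := x) (D := D)) => // _ [U oU <-].
  (* Whether the decoded point lies in [U] is read off single entries of [h w], whose level sets are
     measurable. *)
  have -> : D `&` x @^-1` U = D `&` \bigcup_m \bigcup_k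
      ([set w | h w m.*2 = k] `&` [set _ | ball_inside q U k m]).
    apply/seteqP; split=> w [Dw] /=.
      move=> /(open_encodes oU (xcode w Dw))[m mU]; split=> //.
      by exists m => //; exists (rho (h w) m).
    move=> [m _ [k _ [/= hk kU]]]; split=> //.
    by apply/(open_encodes oU (xcode w Dw)); exists m; rewrite /rho hk.
  apply: measurableI => //; apply: bigcupT_measurable => m.
  apply: bigcupT_measurable => k; apply: measurableI => //.
  exact: measurable_prop.
- move=> w; split=> [Dw|[y Ay]]; first by exists (x w); apply: codeA => //; exact: xcode.
  have [r yr] := encodes_exists q_dense y.
  have [s sB] := (BA r y w yr).1 Ay.
  have er : rho (interleave r s) = r by exact: interleave_even.
  have es : sigma (interleave r s) = s by exact: interleave_odd.
  exists (interleave r s) => n; rewrite /L /= er es; split=> // m k _ _.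
  by rewrite er; exact: (iffLR (encodes_cauchy q r) (ex_intro _ y yr)).
- by move=> w Dw; apply: codeA => //; exact: xcode.
Qed.

(* Completes the join with the normed module structure of matrices, which
   [banach_fixed_point] requires. *)
HB.instance Definition _ (R : realType) (m n : nat) :=
  Uniform_isComplete.Build 'M[R]_(m, n) cauchy_cvg.

(** * Zeros of nearly linear maps *)

Section matrix_norm.
Context (R : realType).

Lemma norm_coord_le m n (M : 'M[R]_(m, n)) i j : `|M i j| <= `|M|.
Proof.
by rewrite [leRHS]/Num.Def.normr/= mx_normrE; exact: (le_bigmax _ _ (i, j)).
Qed.

Lemma norm_mx_le m n (M : 'M[R]_(m, n)) c :
  0 <= c -> (forall i j, `|M i j| <= c) -> `|M| <= c.
Proof.
move=> c0 h; rewrite [leLHS]/Num.Def.normr/= mx_normrE.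
by apply: bigmax_le => // -[i j] _; exact: h.
Qed.

Lemma norm_mulmx_le m n (v : 'rV[R]_m) (M : 'M[R]_(m, n)) :
  `|v *m M| <= m%:R * `|M| * `|v|.
Proof.
apply: norm_mx_le => [|i j]; first by rewrite !mulr_ge0.
rewrite mxE; apply: le_trans (ler_norm_sum _ _ _) _.
apply: (@le_trans _ _ (\sum_(k < m) `|M| * `|v|)); last first.
  by rewrite sumr_const card_ord -mulrA mulr_natl.
apply: ler_sum => k _; rewrite normrM mulrC.
by apply: ler_pM => //; exact: norm_coord_le.
Qed.

End matrix_norm.

Section near_linear.
Context (R : realType) (p : nat).
Implicit Types (f : 'rV[R]_p -> 'rV[R]_p) (x y v : 'rV[R]_p) (A : 'M[R]_p).

Lemma is_derive_line f x v (t : R) (j : 'I_p) :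
  differentiable f (x + t *: v) ->
  is_derive t 1 (fun s : R => f (x + s *: v) ord0 j)
    ((v *m jacobian f (x + t *: v)) ord0 j).
Proof.
move=> df; have dv : derivable f (x + t *: v) v by exact: diff_derivable.
have /derivable_mxP/(_ ord0 j) dj := dv.
have Dj : 'D_v (fun y => f y ord0 j) (x + t *: v) =
    (v *m jacobian f (x + t *: v)) ord0 j.
  by rewrite -deriveEjacobian// derive_mx// mxE.
have e : (fun h : R => h^-1 *: (((fun s : R => f (x + s *: v) ord0 j) \o shift t)
      (h *: 1) - f (x + t *: v) ord0 j)) =
    (fun h : R => h^-1 *: (((fun y => f y ord0 j) \o shift (x + t *: v)) (h *: v)
      - f (x + t *: v) ord0 j)).
  apply/funext => h /=; congr (_ *: (f _ _ _ - _)).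
  by rewrite [h *: 1]mulr1 scalerDl addrCA.
split; first by rewrite /derivable e.
by rewrite /derive e; exact: Dj.
Qed.

Lemma segment_in_ball x0 x y (r t : R) : `|x - x0| <= r -> `|y - x0| <= r ->
  0 <= t <= 1 -> `|x + t *: (y - x) - x0| <= r.
Proof.
move=> xr yr /andP[t0 t1].
have -> : x + t *: (y - x) - x0 = (1 - t) *: (x - x0) + t *: (y - x0).
  apply/matrixP => i j; rewrite !mxE; ring.
apply: le_trans (ler_normD _ _) _; rewrite !normrZ.
rewrite !ger0_norm ?subr_ge0//.
have -> : r = (1 - t) * r + t * r by ring.
by apply: lerD; apply: ler_wpM2l => //; rewrite subr_ge0.
Qed.

(** The mean value theorem is applied to each coordinate along the segment, which suffices for the
    sup norm. Deviations are measured against [v *m A], so no bound on the inverse of [A] enters. *)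
Lemma near_linear_increment f x0 r A :
  (forall x, `|x - x0| <= r -> differentiable f x /\
     forall v, 2 * (p%:R * `|jacobian f x - A| * `|v|) <= `|v *m A|) ->
  forall x y, `|x - x0| <= r -> `|y - x0| <= r ->
    2 * `|f y - f x - (y - x) *m A| <= `|(y - x) *m A|.
Proof.
move=> hf x y xr yr; rewrite -ler_pdivlMl//.
apply: norm_mx_le => [|i j]; first by rewrite mulr_ge0.
rewrite (ord1 i) {i} ler_pdivlMl//.
pose v := y - x.
have [||t t01] := @MVT_segment R (fun s : R => f (x + s *: v) ord0 j)
   (fun s : R => (v *m jacobian f (x + s *: v)) ord0 j) 0 1 ler01.
- move=> t; rewrite in_itv /= => /andP[t0 t1]; apply: is_derive_line.
  by apply: (hf _ _).1; apply: segment_in_ball => //; rewrite !ltW.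
- apply: derivable_within_continuous => t; rewrite in_itv /= => t01.
  have [d _] := is_derive_line j (hf _ (segment_in_ball xr yr t01)).1.
  exact: d.
move: t01; rewrite in_itv /= => t01.
rewrite scale0r addr0 scale1r subr0 mulr1 [x + v]addrC subrK => e.
have [_ /(_ v) hJ] := hf _ (segment_in_ball xr yr t01).
apply: le_trans hJ; rewrite ler_pM2l//.
apply: le_trans (norm_mulmx_le _ _); rewrite mulmxBr.
apply: le_trans (norm_coord_le _ ord0 j).
by rewrite !mxE in e *; rewrite e.
Qed.

(** Equal values force twice the norm of [(y - x) *m A] below that norm itself, so it vanishes, and
    the lower bound on [A] gives [x = y]. *)
Lemma near_linear_inj f x0 r A K :
  (forall x, `|x - x0| <= r -> differentiable f x /\
     forall v, 2 * (p%:R * `|jacobian f x - A| * `|v|) <= `|v *m A|) ->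
  (forall v, `|v| <= K * `|v *m A|) ->
  forall x y, `|x - x0| <= r -> `|y - x0| <= r -> f x = f y -> x = y.
Proof.
move=> hf hA x y xr yr fxy.
have := near_linear_increment hf xr yr; rewrite fxy subrr sub0r normrN => h.
have z : `|(y - x) *m A| = 0 by have := normr_ge0 ((y - x) *m A); lra.
have := hA (y - x); rewrite z mulr0 normr_le0 subr_eq0 => /eqP.
by move=> ->.
Qed.

(** Newton's iteration with frozen derivative [A], written in the variable [u = x *m A]: the map
    sending [u] to [u - f (u *m invmx A)] contracts the closed ball of radius [rho] about [x0 *m A]
    by one half, and its fixed point gives the zero. *)
Lemma near_linear_zero f x0 r rho A K :
  (forall x, `|x - x0| <= r -> differentiable f x /\
     forall v, 2 * (p%:R * `|jacobian f x - A| * `|v|) <= `|v *m A|) ->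
  (forall v, `|v| <= K * `|v *m A|) -> 0 <= rho -> 0 <= K -> K * rho <= r ->
  2 * `|f x0| <= rho ->
  exists x, `|x - x0| <= K * rho /\ f x = 0.
Proof.
move=> hf hA rho0 K0 Kr fx0.
have uA : A \in unitmx.
  rewrite -row_free_unit -kermx_eq0; apply/rowV0P => v /sub_kermxP vA.
  by apply/eqP; rewrite -normr_le0; have := hA v; rewrite vA normr0 mulr0.
pose u0 := x0 *m A.
pose U := [set u : 'rV[R]_p | `|u - u0| <= rho].
pose X u : 'rV[R]_p := u *m invmx A.
have XA u : X u *m A = u by rewrite mulmxKV.
have Xr u : U u -> `|X u - x0| <= K * rho.
  move=> Uu; apply: le_trans (hA _) _.
  apply: ler_wpM2l => //; rewrite (_ : _ *m A = u - u0)//.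
  by rewrite mulmxBl XA.
have X0 : X u0 = x0 by rewrite /X mulmxK.
have U0 : U u0 by rewrite /U /= subrr normr0.
pose g u : 'rV[R]_p := u - f (X u).
have gl u v : U u -> U v -> `|g u - g v| <= 2^-1 * `|u - v|.
  move=> /Xr ur /Xr vr.
  have := near_linear_increment hf (le_trans vr Kr) (le_trans ur Kr).
  rewrite (_ : (X u - X v) *m A = u - v); last by rewrite mulmxBl !XA.
  rewrite -ler_pdivlMl// => h; apply: le_trans h.
  rewrite (_ : g u - g v = - (f (X u) - f (X v) - (u - v))) ?normrN//.
  by apply/matrixP => i j; rewrite !mxE; ring.
have gU : {homo g : u / U u >-> U u}.
  move=> u Uu; rewrite /U /=.
  (* Half of [rho] is used by the contraction estimate, the other half by the bound on [f x0]. *)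
  rewrite (_ : g u - u0 = (g u - g u0) - f x0); last first.
    by apply/matrixP => i j; rewrite /g X0 !mxE; ring.
  apply: le_trans (ler_normB _ _) _.
  by have := gl _ _ Uu U0; move: Uu; rewrite /U /=; lra.
pose gf := mkfun gU.
have ctr : is_contraction (gf : {fun U >-> U}).
  have h0 : 0 <= 2^-1 :> R by [].
  exists (NngNum h0); split=> /=; first by lra.
  by move=> [u v] /= [Uu Uv]; exact: gl.
have cU : closed U.
  have -> : U = closed_ball_ Num.norm u0 rho.
    by apply/seteqP; split=> v; rewrite /U /closed_ball_ /= distrC.
  exact: closed_closed_ball_.
have [u Uu ug] := banach_fixed_point ctr cU (ex_intro _ u0 U0).
exists (X u); split; first exact: Xr.
have /(congr1 (fun z => u - z)) : u = u - f (X u) by exact: ug.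
by rewrite subrr subKr => <-.
Qed.

End near_linear.

(** * Measurability of suprema of Jacobians *)

Section euclidean_norm.
Context (R : realType) (p : nat).
Implicit Types (v : 'rV[R]_p) (A : 'M[R]_p).

Lemma norm_le_enorm v : `|v| <= enorm v.
Proof.
apply: norm_mx_le => [|i j]; first exact: sqrtr_ge0.
rewrite (ord1 i) -sqrtr_sqr ler_wsqrtr// (bigD1 j)//= lerDl.
by apply: sumr_ge0 => k _; exact: sqr_ge0.
Qed.

Lemma enorm_le_norm v : enorm v <= p%:R * `|v|.
Proof.
have pv : 0 <= p%:R * `|v| by rewrite mulr_ge0.
rewrite -[leRHS]ger0_norm// -sqrtr_sqr ler_wsqrtr// exprMn.
apply: (@le_trans _ _ (\sum_(i < p) `|v| ^+ 2)).
  apply: ler_sum => i _; rewrite -real_normK ?num_real//.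
  by rewrite lerXn2r ?nnegrE//; exact: norm_coord_le.
rewrite sumr_const card_ord -[leLHS]mulr_natl ler_wpM2r ?sqr_ge0//.
by rewrite -natrX ler_nat; case: (p) => // m; rewrite expnS leq_pmulr.
Qed.

Lemma enormZ (a : R) v : enorm (a *: v) = `|a| * enorm v.
Proof.
rewrite /enorm -sqrtr_sqr -sqrtrM ?sqr_ge0// mulr_sumr; congr Num.sqrt.
by apply: eq_bigr => i _; rewrite mxE exprMn.
Qed.

Lemma enorm0 : enorm (0 : 'rV[R]_p) = 0.
Proof. by rewrite -(scale0r 0) enormZ normr0 mul0r. Qed.

Lemma sum_sqr_continuous (s : seq 'I_p) :
  continuous (fun v : 'rV[R]_p => \sum_(i <- s) v ord0 i ^+ 2).
Proof.
elim: s => [|i s IH].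
  rewrite (_ : (fun _ => _) = (fun=> 0)); last first.
    by apply/funext => v; rewrite big_nil.
  exact: cst_continuous.
rewrite (_ : (fun _ => _) =
    (fun v => v ord0 i * v ord0 i + \sum_(i <- s) v ord0 i ^+ 2)); last first.
  by apply/funext => v; rewrite big_cons expr2.
move=> v;
have cc := @coord_continuous R 1 p ord0 i v.
exact: (cvgD (cvgM cc cc) (IH v)).
Qed.

Lemma enorm_continuous : continuous (@enorm R p).
Proof.
move=> v; apply: (@continuous_comp _ _ _
  (fun v : 'rV[R]_p => \sum_(i < p) v ord0 i ^+ 2) Num.sqrt).
  exact: sum_sqr_continuous.
exact: sqrt_continuous.
Qed.

Lemma opnorm_ge A v : enorm v <= 1 -> enorm (v *m A) <= opnorm A.
Proof.
move=> v1; apply: ub_le_sup; last by exists v.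
exists (p%:R * (p%:R * `|A|)) => _ [u /= u1 <-].
apply: le_trans (enorm_le_norm _) _; rewrite ler_wpM2l//.
apply: le_trans (norm_mulmx_le _ _) _.
by rewrite -[leRHS]mulr1 ler_wpM2l ?mulr_ge0// (le_trans (norm_le_enorm u)).
Qed.

(** A vector [v] of the closed unit ball with [e < a], where [a = enorm (v *m A)], is scaled by the
    midpoint [s] of [e / a] and 1. The strict bound on the result defines an open set, where a dense
    sequence can be used. *)
Lemma opnorm_gtP A (e : R) : 0 <= e -> e < opnorm A ->
  exists v, enorm v < 1 /\ e < enorm (v *m A).
Proof.
move=> e0 /sup_gt[|_ [v /= v1 <-] ev].
  by exists (enorm (0 *m A)); exists 0 => //=; rewrite enorm0.
set a := enorm (v *m A) in ev.
have a0 : 0 < a by exact: le_lt_trans ev.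
pose s := (e / a + 1) / 2.
have ea1 : e / a < 1 by rewrite ltr_pdivrMr// mul1r.
have ea0 : 0 <= e / a by rewrite divr_ge0// ltW.
have s0 : 0 <= s by rewrite /s; lra.
have s1 : s < 1 by rewrite /s; lra.
exists (s *: v); rewrite -scalemxAl !enormZ ger0_norm// -/a; split.
  by apply: le_lt_trans s1; rewrite -[leRHS]mulr1 ler_wpM2l.
rewrite /s mulrAC mulrDl mul1r -mulrA mulVf ?gt_eqF// mulr1; lra.
Qed.

Lemma norm_le_opnorm A : `|A| <= opnorm A.
Proof.
have o0 : 0 <= opnorm A.
  rewrite -enorm0 -(mul0mx _ A); apply: opnorm_ge.
  by rewrite enorm0.
apply: norm_mx_le => // i j.
have d1 : enorm (delta_mx ord0 i : 'rV[R]_p) <= 1.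
  rewrite /enorm (bigD1 i)//= big1 ?addr0 => [|k ki].
    by rewrite mxE !eqxx expr1n sqrtr1.
  by rewrite mxE (negbTE ki) andbF expr0n.
apply: le_trans (opnorm_ge _ d1); rewrite -rowE.
have -> : A i j = row i A ord0 j by rewrite mxE.
exact: le_trans (norm_coord_le _ _ _) (norm_le_enorm _).
Qed.

End euclidean_norm.

Section measurable_matrix.
Context d (T : measurableType d) (R : realType).
Implicit Types D : set T.

Lemma measurable_lt_set D (f g : T -> R) : measurable D ->
  measurable_fun D f -> measurable_fun D g -> measurable (D `&` [set w | f w < g w]).
Proof.
move=> mD mf mg.
have -> : D `&` [set w | f w < g w] = D `\` (D `&` [set w | g w <= f w]).
  apply/seteqP; split=> w [Dw] /=.
    by move=> fg; split=> // -[_]; rewrite leNgt fg.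
  by move=> h; split=> //; rewrite ltNge; apply/negP => gf; exact: h.
by apply: measurableD => //; exact: measurable_fun_le.
Qed.

Lemma measurable_norm_mx m n D (M : T -> 'M[R]_(m, n)) :
  (forall i j, measurable_fun D (fun w => M w i j)) ->
  measurable_fun D (fun w => `|M w|).
Proof.
move=> mM.
rewrite (_ : (fun _ => _) =
    (fun w => \big[Order.max/0]_(ij : 'I_m * 'I_n) `|M w ij.1 ij.2|)); last first.
  by apply/funext => w; rewrite [LHS]/Num.Def.normr/= mx_normrE.
elim: (index_enum _) => [|ij s IH].
  rewrite (_ : (fun _ => _) = cst 0); first exact: measurable_cst.
  by apply/funext => w; rewrite big_nil.
rewrite (_ : (fun _ => _) = (fun w => `|M w ij.1 ij.2|) \max
    (fun w => \big[Order.max/0]_(ij <- s) `|M w ij.1 ij.2|)); last first.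
  by apply/funext => w; rewrite big_cons.
by apply: measurable_maxr => //; apply: measurableT_comp.
Qed.

(** The open preimage under [g] is a countable union of balls around a dense sequence, and lying in
    such a ball is a condition on the entries. *)
Lemma measurable_continuous_mx m n D (M : T -> 'M[R]_(m, n))
    (g : 'M[R]_(m, n) -> R) :
  (forall i j, measurable_fun D (fun w => M w i j)) -> continuous g ->
  measurable_fun D (g \o M).
Proof.
move=> mM cg mD; have [q q_dense] := dense_sequence R m n.
apply: (measurability _ (measurable_realfun.RGenOpens.measurableE R)) => //.
move=> _ [_ [a [b ->]] <-]; set U := `]a, b[%classic.
have oU : open U by exact: interval_open.
have oV : open (g @^-1` U) by move/continuousP: cg; exact.
have -> : D `&` (g \o M) @^-1` U = \bigcup_k \bigcup_l
  (D `&` ([set w | `|M w - q k| < l.+1%:R^-1] `&`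
   [set _ | forall y, `|y - q k| < l.+1%:R^-1 -> U (g y)])).
  apply/seteqP; split=> w; last first.
    by move=> [k _ [l _ [Dw [/= wk kU]]]]; split=> //; exact: kU.
  move=> [Dw /= Uw].
  have /nbhs_ballP[e /= e0 eU] := open_nbhs_nbhs (conj oV Uw).
  have e20 : 0 < e / 2 by rewrite divr_gt0.
  have [l le] := natSinv_lt e20.
  have [k kM] := q_dense (M w) l.+1%:R^-1 ltac:(by rewrite invr_gt0).
  exists k => //; exists l => //; split=> //; split; first by rewrite /= distrC.
  move=> y yq; apply: eU; rewrite -ball_normE /=.
  rewrite (_ : M w - y = (q k - y) - (q k - M w)); last first.
    by rewrite opprB [RHS]addrC addrA subrK.
  apply: le_lt_trans (ler_normB _ _) _; rewrite (splitr e) ltrD//.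
    by rewrite distrC (lt_trans yq).
  exact: lt_trans le.
apply: bigcupT_measurable => k; apply: bigcupT_measurable => l.
rewrite setIA; apply: measurableI; last exact: measurable_prop.
apply: measurable_lt_set => //; apply: measurable_norm_mx => i j.
rewrite (_ : (fun _ => _) = (fun w => M w i j) \- cst (q k i j)); last first.
  by apply/funext => w; rewrite !mxE.
exact: measurable_funB.
Qed.

Lemma measurable_continuous_borelRV p D (f : T -> borelRV R p)
    (g : 'rV[R]_p -> R) :
  measurable_fun D f -> continuous g -> measurable_fun D (g \o f).
Proof.
move=> mf cg mD.
apply: (measurability _ (measurable_realfun.RGenOpens.measurableE R)) => //.
move=> _ [_ [a [b ->]] <-]; set U := `]a, b[%classic.
have oU : open U by exact: interval_open.
rewrite comp_preimage; apply: mf => //.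
apply: sub_sigma_algebra; move/continuousP: cg; exact.
Qed.

(** The device that replaces uncountable suprema and quantifiers by countable ones: a strict
    inequality at a point persists at a nearby member of the sequence. *)
Lemma dense_gt m n (q : nat -> 'M[R]_(m, n))
    (q_dense : forall x e, 0 < e -> exists k, `|q k - x| < e)
    (O : set 'M[R]_(m, n)) (g : 'M[R]_(m, n) -> R) x c :
  nbhs x O -> {for x, continuous g} -> c < g x -> exists k, O (q k) /\ c < g (q k).
Proof.
move=> xO gx cx.
have xc : nbhs x (fun y => c < g y) by exact: (cvgr_gt (g x) gx).
have /nbhs_ballP[e /= e0 eU] : nbhs x (O `&` [set y | c < g y]) by exact: filterI.
have [k ke] := q_dense x e e0; exists k; apply: eU.
by rewrite -ball_normE /= distrC.
Qed.

(** Each entry is a pointwise limit of difference quotients along a coordinate direction, and these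
    are measurable. *)
Lemma measurable_jacobian p D (f : 'rV[R]_p -> T -> 'rV[R]_p) (M : set 'rV[R]_p) theta :
  open_nbhs theta M ->
  (forall x, M x -> forall j, measurable_fun D (fun w => f x w ord0 j)) ->
  (forall w, D w -> differentiable (f ^~ w) theta) ->
  forall i j, measurable_fun D (fun w => jacobian (f ^~ w) theta i j).
Proof.
move=> /open_nbhs_nbhs thM mf df i j.
pose v : 'rV[R]_p := delta_mx ord0 i.
have v1 : `|v| <= 1.
  by apply: norm_mx_le => // k l; rewrite mxE; case: andP => _; rewrite ?normr1 ?normr0.
have /nbhs_ballP[e /= e0 eM] := thM.
have [n0 n0e] := natSinv_lt e0.
(* Starting the steps at [n0] keeps all the shifted points inside [M]. *)
pose h (n : nat) : R := (n + n0).+1%:R^-1.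
have h_gt0 n : 0 < h n by rewrite invr_gt0.
have hM n : M (h n *: v + theta).
  apply: eM; rewrite -ball_normE /= opprD addrCA subrr addr0 normrN normrZ.
  rewrite gtr0_norm//; apply: le_lt_trans n0e.
  apply: (@le_trans _ _ (h n)); first by rewrite -[leRHS]mulr1 ler_wpM2l// ltW.
  by rewrite lef_pV2 ?posrE// ler_nat ltnS leq_addl.
apply: (@measurable_realfun.measurable_fun_cvg _ _ _ _
  (fun n w => (h n)^-1 * (f (h n *: v + theta) w ord0 j - f theta w ord0 j))).
  move=> n; apply: measurable_funM => //; apply: measurable_funB; apply: mf => //.
  exact: nbhs_singleton.
move=> w Dw; have dw := df w Dw.
have dv : derivable (f ^~ w) theta v by exact: diff_derivable.
have dj : derivable (fun x => f x w ord0 j) theta v.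
  by have /derivable_mxP := dv; exact.
have -> : jacobian (f ^~ w) theta i j = 'D_v (fun x => f x w ord0 j) theta.
  transitivity (('D_v (f ^~ w) theta) ord0 j).
    rewrite deriveEjacobian; last exact: dw.
    by rewrite -rowE [RHS]mxE.
  by rewrite derive_mx// mxE.
have /cvgr_dnbhsP := dj; apply; split=> [n|].
  by rewrite gt_eqF.
apply/cvgrPdist_lt => c c0; have [N Nc] := natSinv_lt c0.
exists N => // n /= Nn; rewrite sub0r normrN gtr0_norm//.
apply: le_lt_trans Nc; rewrite lef_pV2 ?posrE// ler_nat ltnS.
exact: leq_trans (leq_addr _ _).
Qed.

End measurable_matrix.

Section lipschitz_matrix.
Context (R : realType).

Lemma lipschitz_mx_continuous m n m' n' (f : 'M[R]_(m, n) -> 'M[R]_(m', n')) c :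
  0 <= c -> (forall x y, `|f x - f y| <= c * `|x - y|) -> continuous f.
Proof.
move=> c0 fc x A /= /(nbhs_ballP (f x))[e /= e0 eA].
have c1 : 0 < c + 1 by rewrite ltr_pwDr.
apply/(nbhs_ballP x); exists (e / (c + 1)); first by rewrite /= divr_gt0.
move=> y; rewrite -ball_normE /= ltr_pdivlMr// => xy.
apply: eA; rewrite -ball_normE /=.
apply: le_lt_trans xy; apply: le_trans (fc x y) _.
by rewrite mulrC ler_wpM2l// lerDl.
Qed.

Lemma mulmx_continuous m n (A : 'M[R]_(m, n)) :
  continuous (fun v : 'rV[R]_m => v *m A).
Proof.
apply: (@lipschitz_mx_continuous _ _ _ _ _ (m%:R * `|A|)) => [|x y].
  by rewrite mulr_ge0.
by rewrite -mulmxBl norm_mulmx_le.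
Qed.

Lemma mulmx_continuous_r m n (v : 'rV[R]_m) :
  continuous (fun A : 'M[R]_(m, n) => v *m A).
Proof.
apply: (@lipschitz_mx_continuous _ _ _ _ _ (m%:R * `|v|)) => [|A B].
  by rewrite mulr_ge0.
by rewrite -mulmxBr mulrAC norm_mulmx_le.
Qed.

End lipschitz_matrix.

Section events.
Context (R : realType) (p : nat) d (T : measurableType d).
Variables (D : set T) (M : set 'rV[R]_p) (J : 'rV[R]_p -> T -> 'M[R]_p).
Hypothesis mD : measurable D.
Hypothesis J_meas : forall x, M x ->
  forall i j, measurable_fun D (fun w => J x w i j).
Hypothesis J_cont : forall w, D w ->
  forall x, M x -> {for x, continuous (fun y => J y w)}.

Lemma measurable_enorm_mulmx (v : 'rV[R]_p) x : M x ->
  measurable_fun D (fun w => enorm (v *m J x w)).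
Proof.
move=> Mx; have cg : continuous (fun A : 'M[R]_p => enorm (v *m A)).
  move=> A; apply: (@continuous_comp _ _ _ (fun A : 'M[R]_p => v *m A) (@enorm R p)).
    exact: mulmx_continuous_r.
  exact: enorm_continuous.
exact: (measurable_continuous_mx (J_meas Mx) cg).
Qed.

Lemma measurable_norm_mulmx (v : 'rV[R]_p) x : M x ->
  measurable_fun D (fun w => `|v *m J x w|).
Proof.
move=> Mx; have cg : continuous (fun A : 'M[R]_p => `|v *m A|).
  move=> A; apply: (@continuous_comp _ _ _ (fun A : 'M[R]_p => v *m A) Num.norm).
    exact: mulmx_continuous_r.
  exact: norm_continuous.
exact: (measurable_continuous_mx (J_meas Mx) cg).
Qed.

(** The supremum exceeds [e] exactly when some point of [M] and some vector of the open unit ball,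
    both from the dense sequence, show it. The vector is made dense first, then the point. *)
Lemma measurable_sup_opnorm (e : R) : open M -> 0 <= e ->
  measurable (D `&` [set w | (e%:E < ereal_sup [set (opnorm (J x w))%:E | x in M])%E]).
Proof.
move=> oM e0; have [q q_dense] := dense_sequence R 1 p.
pose N k l := if pselect (M (q k) /\ enorm (q l) < 1) is left _ then
  D `&` [set w | e < enorm (q l *m J (q k) w)] else set0.
have -> : D `&` [set w | (e%:E < ereal_sup [set (opnorm (J x w))%:E | x in M])%E] =
    \bigcup_k \bigcup_l N k l.
  apply/seteqP; split=> w /=; last first.
    move=> [k _ [l _]]; rewrite /N; case: pselect => // -[Mk l1] [Dw /= ew].
    split=> //; apply: (@lt_le_trans _ _ (opnorm (J (q k) w))%:E).
      by rewrite lte_fin (lt_le_trans ew)// opnorm_ge// ltW.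
    by apply: ereal_sup_ubound; exists (q k).
  move=> [Dw /ereal_sup_gt[_ [x Mx <-]]]; rewrite lte_fin.
  move=> /(opnorm_gtP e0)[v [v1 ev]].
  have [l [l1 el]] : exists l, enorm (q l) < 1 /\ e < enorm (q l *m J x w).
    apply: (dense_gt q_dense (O := [set v | enorm v < 1])
      (g := fun v => enorm (v *m J x w)) (x := v)) => //.
      apply: open_nbhs_nbhs; split=> //.
      have /continuousP cE := @enorm_continuous R p.
      exact: (cE [set x | x < 1] (@open_lt _ 1)).
    apply: (@continuous_comp _ _ _ (fun v : 'rV[R]_p => v *m J x w) (@enorm R p)).
      exact: mulmx_continuous.
    exact: enorm_continuous.
  have [k [Mk ek]] : exists k, M (q k) /\ e < enorm (q l *m J (q k) w).
    apply: (dense_gt q_dense (O := M)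
      (g := fun x => enorm (q l *m J x w)) (x := x)) => //.
      by apply: open_nbhs_nbhs; split.
    apply: (@continuous_comp _ _ _ (fun x => q l *m J x w) (@enorm R p)); last first.
      exact: enorm_continuous.
    apply: (@continuous_comp _ _ _ (fun x => J x w) (fun A => q l *m A)).
      exact: J_cont.
    exact: mulmx_continuous_r.
  by exists k => //; exists l => //; rewrite /N; case: pselect => // -[].
apply: bigcupT_measurable => k; apply: bigcupT_measurable => l.
rewrite /N; case: pselect => // -[Mk _]; apply: measurable_lt_set => //.
exact: measurable_enorm_mulmx.
Qed.

End events.

Lemma measurable_sup_opnorm_sub (R : realType) (p : nat) d (T : measurableType d)
    (D : set T) (M : set 'rV[R]_p) (J J' : 'rV[R]_p -> T -> 'M[R]_p) (e : R) :
  measurable D ->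
  (forall x, M x -> forall i j, measurable_fun D (fun w => J x w i j)) ->
  (forall x, M x -> forall i j, measurable_fun D (fun w => J' x w i j)) ->
  (forall w, D w -> forall x, M x -> {for x, continuous (fun y => J y w)}) ->
  (forall w, D w -> forall x, M x -> {for x, continuous (fun y => J' y w)}) ->
  open M -> 0 <= e ->
  measurable (D `&`
    [set w | (e%:E < ereal_sup [set (opnorm (J x w - J' x w))%:E | x in M])%E]).
Proof.
move=> mD mJ mJ' cJ cJ'.
apply: (measurable_sup_opnorm (J := fun x w => J x w - J' x w)) => //.
  move=> x Mx i j.
  rewrite (_ : (fun _ => _) = (fun w => J x w i j) \- (fun w => J' x w i j)).
    by apply: measurable_funB; [exact: mJ|exact: mJ'].
  by apply/funext => w; rewrite !mxE.
by move=> w Dw x Mx; exact: (cvgB (cJ w Dw x Mx) (cJ' w Dw x Mx)).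
Qed.

(** * Uniformly invertible Jacobians *)

Section good_events.
Context (R : realType) (p : nat) d (T : measurableType d) (P : probability T R).
Variables (D : set T) (M : set 'rV[R]_p) (J : 'rV[R]_p -> T -> 'M[R]_p).
Variable x0 : 'rV[R]_p.
Hypothesis mD : measurable D.
Hypothesis D1 : P (~` D) = 0%E.
Hypothesis Mx0 : open_nbhs x0 M.
Hypothesis J_meas : forall x, M x ->
  forall i j, measurable_fun D (fun w => J x w i j).
Hypothesis J_cont : forall w, D w ->
  forall x, M x -> {for x, continuous (fun y => J y w)}.
Hypothesis J_unit : forall w, D w -> J x0 w \in unitmx.

(** The second clause bounds the inverse of [J x0 w] by [k.+1]. The first has 4 where
    [near_linear_increment] has 2: it spends half of the allowed deviation and leaves the rest for
    replacing [J] by the Jacobian of another map. *)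
Definition good_event (rad : R) (k : nat) : set T :=
  [set w | (forall x, `|x - x0| < rad -> forall v : 'rV[R]_p,
     4 * (p%:R * `|J x w - J x0 w| * `|v|) <= `|v *m J x0 w|) /\
   (forall v : 'rV[R]_p, `|v| <= k.+1%:R * `|v *m J x0 w|)].

Lemma affine_norm_continuous (A : 'M[R]_p) (a b : R) :
  continuous (fun v : 'rV[R]_p => a * `|v| - b * `|v *m A|).
Proof.
have h (c : R) (B : 'M[R]_p) : continuous (fun v : 'rV[R]_p => c * `|v *m B|).
  move=> v; apply: (@continuous_comp _ _ _ (fun v : 'rV[R]_p => `|v *m B|) ( *%R c)).
    apply: (@continuous_comp _ _ _ (fun v : 'rV[R]_p => v *m B) Num.norm).
      exact: mulmx_continuous.
    exact: norm_continuous.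
  exact: mulrl_continuous.
move=> v; have h1 := h a 1%:M v; have h2 := h b A v.
rewrite (_ : (fun v => _) = (fun v => a * `|v *m 1%:M| - b * `|v *m A|)).
  exact: (cvgB h1 h2).
by apply/funext => u; rewrite mulmx1.
Qed.

Lemma dense_affine_norm_le (q : nat -> 'rV[R]_p)
    (q_dense : forall x e, 0 < e -> exists k, `|q k - x| < e)
    (A : 'M[R]_p) (a b : R) :
  (forall k, a * `|q k| <= b * `|q k *m A|) -> forall v : 'rV[R]_p, a * `|v| <= b * `|v *m A|.
Proof.
move=> h v; rewrite leNgt; apply/negP; rewrite -subr_gt0 => v0.
have [k [_]] := dense_gt q_dense filterT (@affine_norm_continuous A a b v) v0.
by rewrite subr_gt0 ltNge h.
Qed.

(** Both clauses are non-strict inequalities between continuous functions, so it is enough to test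
    them on a dense sequence of points and vectors. *)
Lemma measurable_good_event (rad : R) k :
  (forall x, `|x - x0| < rad -> M x) -> measurable (D `&` good_event rad k).
Proof.
move=> radM; have [q q_dense] := dense_sequence R 1 p.
have Mx : M x0 by case: Mx0.
pose E1 i l := if pselect (`|q i - x0| < rad) is left _ then
  D `&` [set w | 4 * (p%:R * `|J (q i) w - J x0 w| * `|q l|) <= `|q l *m J x0 w|]
  else D.
pose E2 l := D `&` [set w | `|q l| <= k.+1%:R * `|q l *m J x0 w|].
have -> : D `&` good_event rad k =
    D `&` (\bigcap_i \bigcap_l E1 i l) `&` (\bigcap_l E2 l).
  apply/seteqP; split=> w.
    move=> [Dw [h1 h2]]; split; last by move=> l _; split=> //; exact: h2.
    split=> // i _ l _; rewrite /E1; case: pselect => // ir; split=> //=.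
    exact: h1.
  move=> [[Dw h1] h2]; split=> //; split; last first.
    move=> v; rewrite -[leLHS]mul1r; apply: (dense_affine_norm_le q_dense) => l.
    by rewrite mul1r; have [] := h2 l I.
  move=> x xr v; rewrite -[leRHS]mul1r !mulrA.
  apply: (dense_affine_norm_le q_dense) => l.
  rewrite mul1r -!mulrA leNgt; apply/negP => ex.
  pose g x := 4 * p%:R * `|q l| * `|J x w - J x0 w|.
  have gE y : g y = 4 * (p%:R * (`|J y w - J x0 w| * `|q l|)).
    by rewrite /g -!mulrA [`|q l| * _]mulrC.
  have gc : {for x, continuous g}.
    apply: (@continuous_comp _ _ _ (fun x => `|J x w - J x0 w|)
      ( *%R (4 * p%:R * `|q l|))); last exact: mulrl_continuous.
    apply: (@continuous_comp _ _ _ (fun x => J x w - J x0 w) Num.norm); last first.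
      exact: norm_continuous.
    have c1 := J_cont Dw (radM _ xr).
    exact: (cvgB c1 (cvg_cst _)).
  have nx : nbhs x [set y | `|y - x0| < rad].
    apply: open_nbhs_nbhs; split=> //.
    rewrite (_ : [set _ | _] = ball x0 rad); first exact: ball_open.
    by apply/seteqP; split=> y; rewrite -ball_normE /= distrC.
  rewrite -gE in ex; have [i [ir]] := dense_gt q_dense nx gc ex.
  rewrite gE; have := h1 i I l I; rewrite /E1; case: pselect => // _ [_ /=].
  by rewrite -!mulrA leNgt => /negP.
have mA l : measurable_fun D (fun w => `|q l *m J x0 w|).
  exact: (measurable_norm_mulmx J_meas (q l) Mx).
apply: measurableI.
  apply: measurableI => //; apply: bigcapT_measurable => i.
  apply: bigcapT_measurable => l; rewrite /E1; case: pselect => // ir.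
  apply: measurable_fun_le => //.
  have mN : measurable_fun D (fun w => `|J (q i) w - J x0 w|).
    apply: measurable_norm_mx => a b.
    rewrite (_ : (fun _ => _) = (fun w => J (q i) w a b) \- (fun w => J x0 w a b)).
      by apply: measurable_funB; apply: J_meas => //; exact: radM.
    by apply/funext => w; rewrite !mxE.
  by apply: measurable_funM => //; apply: measurable_funM => //; apply: measurable_funM.
apply: bigcapT_measurable => l; apply: measurable_fun_le => //.
exact: measurable_funM.
Qed.

Lemma good_event_exists (r0 : R) w : 0 < r0 -> D w ->
  exists k, good_event (r0 / k.+1%:R) k w.
Proof.
move=> r00 Dw; have Mx : M x0 by case: Mx0.
set A := J x0 w.
(* A bound for the inverse of [A]; the summand 1 makes it positive. *)
pose K := p%:R * `|invmx A| + 1.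
have K0 : 0 < K by rewrite ltr_pwDr// mulr_ge0.
have hA (v : 'rV[R]_p) : `|v| <= K * `|v *m A|.
  rewrite -{1}(mulmxK (J_unit Dw) v).
  apply: le_trans (norm_mulmx_le _ _) _.
  by rewrite ler_wpM2r// lerDl.
(* Chosen so that [4 * p%:R * K * eta <= 1], which turns closeness of the Jacobians into the first
   clause. *)
pose eta := (4 * p%:R * K + 1)^-1.
have c0 : 0 < 4 * p%:R * K + 1 by rewrite ltr_pwDr// !mulr_ge0// ltW.
have eta0 : 0 < eta by rewrite invr_gt0.
have /(_ _ (nbhsx_ballx A eta eta0)) := J_cont Dw Mx.
move=> /(nbhs_ballP x0)[del /= del0 hdel].
have [n1 n1P] := natSinv_lt (divr_gt0 del0 r00).
have [n2 n2P] := natSinv_lt (ltac:(by rewrite invr_gt0) : 0 < K^-1).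
(* [n1] makes the radius smaller than the modulus of continuity [del], and [n2] makes [k.+1] at
   least [K]. *)
exists (maxn n1 n2); set k := maxn n1 n2.
have k1 : r0 / k.+1%:R < del.
  rewrite mulrC -ltr_pdivlMr//; apply: le_lt_trans n1P.
  by rewrite lef_pV2 ?posrE// ler_nat ltnS leq_maxl.
have k2 : K <= k.+1%:R.
  rewrite -lef_pV2 ?posrE//; apply: le_trans (ltW n2P).
  by rewrite lef_pV2 ?posrE// ler_nat ltnS leq_maxr.
split=> [x xr v|v]; last by apply: le_trans (hA v) _; rewrite ler_wpM2r.
have xe : `|J x w - A| <= eta.
  have : ball A eta (J x w).
    by apply: hdel; rewrite -ball_normE /= distrC (lt_trans xr).
  by rewrite -ball_normE /= distrC => /ltW.
apply: (@le_trans _ _ (4 * (p%:R * eta * (K * `|v *m A|)))).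
  rewrite ler_wpM2l// ler_pM ?mulr_ge0//; first by rewrite ler_wpM2l.
rewrite (_ : 4 * _ = (4 * p%:R * K * eta) * `|v *m A|); last by ring.
rewrite -[leRHS]mul1r ler_wpM2r// /eta ler_pdivrMr// mul1r lerDl.
exact: ler01.
Qed.

(** The good events grow with [k], as the radius shrinks and the bound on the inverse relaxes, and
    they exhaust [D]; continuity from above applies to their complements. *)
Lemma good_event_cvg (r0 : R) : 0 < r0 -> (forall x, `|x - x0| < r0 -> M x) ->
  P (~` (D `&` good_event (r0 / k.+1%:R) k)) @[k --> \oo] --> 0%E.
Proof.
move=> r00 r0M.
pose F k := ~` (D `&` good_event (r0 / k.+1%:R) k).
have rk k : r0 / k.+1%:R <= r0.
  by rewrite ler_pdivrMr// ler_peMr ?(ltW r00)// ler1n.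
have mF k : measurable (F k).
  apply: measurableC; apply: measurable_good_event => x xr; apply: r0M.
  exact: lt_le_trans xr (rk k).
have capF : \bigcap_k F k = ~` D.
  apply/seteqP; split=> w /=.
    move=> h Dw; have [k kw] := good_event_exists r00 Dw.
    exact: (h k I).
  by move=> nDw k _ [].
suff : P (F k) @[k --> \oo] --> P (\bigcap_k F k) by rewrite capF D1.
apply: nonincreasing_cvg_mu.
- by rewrite ltey_eq fin_num_measure//; exact: mF.
- exact: mF.
- exact: bigcapT_measurable.
- apply/nonincreasing_seqP => k; apply/subsetPset; apply: subsetC.
  move=> w [Dw [h1 h2]]; split=> //; split=> [x xr|v].
    apply: h1; apply: lt_le_trans xr _.
    by rewrite ler_wpM2l ?(ltW r00)// lef_pV2 ?posrE// ler_nat.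
  by apply: le_trans (h2 v) _; rewrite ler_wpM2r// ler_nat.
Qed.

End good_events.

(** * Estimators *)

Section convergence_in_probability.
Context d (T : measurableType d) (R : realType) (P : probability T R).
Implicit Types A B Y : nat -> set T.

Lemma prob_cvg0P A : (forall n, measurable (A n)) ->
  P (A n) @[n --> \oo] --> 0%E <->
  forall e : R, 0 < e -> \forall n \near \oo, (P (A n) <= e%:E)%E.
Proof.
move=> mA; have fA n : P (A n) \is a fin_num by exact: fin_num_measure.
split=> [/fine_cvgP[_ /cvgrPdist_le h] e e0|h].
  have := h e e0; apply: filterS => n /=; rewrite sub0r normrN ger0_norm.
    by rewrite -lee_fin fineK.
  by rewrite fine_ge0.
apply/fine_cvgP; split; first exact: nearW.
apply/cvgrPdist_le => e e0; have := h e e0; apply: filterS => n /=.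
rewrite sub0r normrN ger0_norm ?fine_ge0//.
by rewrite -lee_fin fineK.
Qed.

Lemma prob_cvg0_sub A B : (forall n, measurable (A n)) -> (forall n, measurable (B n)) ->
  (\forall n \near \oo, A n `<=` B n) ->
  P (B n) @[n --> \oo] --> 0%E -> P (A n) @[n --> \oo] --> 0%E.
Proof.
move=> mA mB AB /(prob_cvg0P mB) hB; apply/(prob_cvg0P mA) => e e0.
have := hB e e0; apply: filterS2 AB => n AB; apply: le_trans.
by apply: le_measure; rewrite ?inE.
Qed.

Lemma prob_cvg0U A B : (forall n, measurable (A n)) -> (forall n, measurable (B n)) ->
  P (A n) @[n --> \oo] --> 0%E -> P (B n) @[n --> \oo] --> 0%E ->
  P (A n `|` B n) @[n --> \oo] --> 0%E.
Proof.
move=> mA mB /(prob_cvg0P mA) hA /(prob_cvg0P mB) hB.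
have mU n : measurable (A n `|` B n) by exact: measurableU.
apply/(prob_cvg0P mU) => e e0.
have e20 : 0 < e / 2 by rewrite divr_gt0.
have := hB _ e20; apply: filterS2 (hA _ e20) => n An Bn.
by rewrite (splitr e) EFinD (le_trans (measureU2 _ _ _))// leeD.
Qed.

(** First [k] is fixed to make [Z k] small, uniformly in [n]; then [n] grows. The events [Y] may
    therefore depend on [k]. *)
Lemma prob_cvg0_approx A (Z : nat -> set T) :
  (forall n, measurable (A n)) -> (forall k, measurable (Z k)) ->
  P (Z k) @[k --> \oo] --> 0%E ->
  (forall k, exists Y, [/\ forall n, measurable (Y n),
     P (Y n) @[n --> \oo] --> 0%E & forall n, A n `<=` Z k `|` Y n]) ->
  P (A n) @[n --> \oo] --> 0%E.
Proof.
move=> mA mZ /(prob_cvg0P mZ) hZ hY; apply/(prob_cvg0P mA) => e e0.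
have e20 : 0 < e / 2 by rewrite divr_gt0.
have [k _ /(_ k (leqnn k)) Zk] := hZ _ e20.
have [Y [mY /(prob_cvg0P mY) /(_ _ e20) cY AY]] := hY k.
apply: filterS cY => n Yn; rewrite (splitr e) EFinD.
apply: (@le_trans _ _ (P (Z k `|` Y n))).
  by apply: le_measure; rewrite ?inE//; exact: measurableU.
by rewrite (le_trans (measureU2 _ _ _))// leeD.
Qed.

End convergence_in_probability.

(** * Measurability and selection in the extended parameter set *)

Section delta_measurability.
Context d (T : measurableType d) (R : realType) (p : nat) (F : set (set T)).
Hypothesis sF : sigma_algebra [set: T] F.
Implicit Types h : T -> option 'rV[R]_p.

Lemma sub_measurableE : (measurable : set (set (g_sigma_algebraType F))) = F.
Proof. exact: sigma_algebra_id. Qed.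

Lemma measurable_delta_ltr h (x : 'rV[R]_p) (e : R) : measurable_delta F h ->
  F [set w | e < dist_delta (h w) (Some x)].
Proof.
move=> mh; apply: (mh [set y | e < dist_delta y (Some x)]).
apply: sub_sigma_algebra.
have c : continuous (fun y : 'rV[R]_p => enorm (y - x)).
  move=> y; apply: (@continuous_comp _ _ _ (fun y : 'rV[R]_p => y - x) (@enorm R p)).
    exact: (cvgB (@cvg_id _ (nbhs y)) (cvg_cst _)).
  exact: enorm_continuous.
move/continuousP : c => c; exact: (c [set t | e < t] (@open_gt _ e)).
Qed.

(** Two distinct values are separated by a ball of a countable family, the extra point lying in none
    of them. So disagreement is a countable union of differences of preimages. *)
Lemma measurable_delta_neq h h' : measurable_delta F h -> measurable_delta F h' ->
  F [set w | h w <> h' w].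
Proof.
move=> mh mh'; have [q q_dense] := dense_sequence R 1 p.
pose C k l : set (option 'rV[R]_p) :=
  [set y | if y is Some x then `|x - q k| < l.+1%:R^-1 else False].
have mC k l : measurable (Some @^-1` C k l : set (borelRV R p)).
  apply: sub_sigma_algebra; rewrite (_ : _ @^-1` _ = ball (q k) l.+1%:R^-1).
    exact: ball_open.
  by apply/seteqP; split=> y; rewrite -ball_normE /= distrC.
have sep (x : 'rV[R]_p) y : Some x <> y -> exists k l, C k l (Some x) /\ ~ C k l y.
  case: y => [y|] xy; last first.
    have [k kx] := q_dense x 1%:R^-1 ltac:(by rewrite invr_gt0).
    exists k, 0%N; split; last by [].
    by rewrite /C /= distrC.
  have e0 : 0 < `|x - y| / 2.
    by rewrite divr_gt0// normr_gt0 subr_eq0; apply/eqP => exy; apply: xy; rewrite exy.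
  have [l le] := natSinv_lt e0.
  have [k kx] := q_dense x l.+1%:R^-1 ltac:(by rewrite invr_gt0).
  exists k, l; rewrite /C /= distrC; split=> // yk.
  have : `|x - y| < `|x - y|.
    rewrite {1}(_ : x - y = (q k - y) - (q k - x)); last first.
      by rewrite opprB [RHS]addrC addrA subrK.
    apply: le_lt_trans (ler_normB _ _) _; rewrite [ltRHS]splitr ltrD//.
      by rewrite distrC (lt_trans yk).
    exact: lt_trans kx le.
  by rewrite ltxx.
have -> : [set w | h w <> h' w] = \bigcup_k \bigcup_l
    ((h @^-1` C k l `\` h' @^-1` C k l) `|` (h' @^-1` C k l `\` h @^-1` C k l)).
  apply/seteqP; split=> w /=; last first.
    move=> [k _ [l _ hkl]] e; case: hkl => -[] /=; rewrite e => c nc; exact: nc.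
  case hw : (h w) => [x|]; case hw' : (h' w) => [y|] // xy.
  - by have [k [l [c1 c2]]] := sep _ _ xy; exists k => //; exists l => //; left; rewrite /= hw hw'.
  - by have [k [l [c1 c2]]] := sep _ _ xy; exists k => //; exists l => //; left; rewrite /= hw hw'.
  - have [k [l [c1 c2]]] := sep y None ltac:(by []).
    by exists k => //; exists l => //; right; rewrite /= hw hw'.
have mh1 k l : F (h @^-1` C k l) by exact: mh.
have mh1' k l : F (h' @^-1` C k l) by exact: mh'.
rewrite -sub_measurableE in mh1 mh1' *.
apply: bigcupT_measurable => k; apply: bigcupT_measurable => l.
by apply: measurableU; apply: measurableD.
Qed.

End delta_measurability.

(** Measurable selection is applied on the smaller sigma-field [F], with the restriction of [P]
    obtained as its image under the identity; its completeness is that of [F]. *)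
Lemma delta_selection d (T : measurableType d) (R : realType) (p : nat)
    (P : probability T R) (F : set (set T)) (A : set (borelRV R p * g_sigma_algebraType F)) :
  complete_sub_sigma_field P F -> measurable A ->
  exists h : T -> option 'rV[R]_p, measurable_delta F h /\
    forall w, if h w is Some x then A (x, w) else forall x, ~ A (x, w).
Proof.
move=> [sF FT Fc] mA.
have mE := sub_measurableE sF.
have mid : measurable_fun [set: T] (id : T -> g_sigma_algebraType F).
  by move=> _ B mB; rewrite setTI; apply: FT; rewrite -mE.
pose X : {mfun T >-> g_sigma_algebraType F} := mfun_Sub (mem_set mid).
pose mu : {measure set (g_sigma_algebraType F) -> \bar R} := distribution P X.
have mu_fin : (mu [set: g_sigma_algebraType F] < +oo)%E.
  by rewrite /mu /= probability_setT ltry.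
have mu_c : measure_is_complete mu.
  move=> B [N [mN N0 BN]]; rewrite mE in mN *; apply: Fc mN _ BN.
  by rewrite -[RHS]N0.
have [D [x [mD mx DA xA]]] := measurable_selection mu_fin mu_c mA.
exists (fun w => if pselect (D w) is left _ then Some (x w) else None); split.
  move=> B mB; rewrite -mE.
  have -> : (fun w => if pselect (D w) is left _ then Some (x w) else None) @^-1` B =
      (D `&` x @^-1` (Some @^-1` B)) `|` (if pselect (B None) is left _ then ~` D else set0).
    apply/seteqP; split=> w /=.
      by case: pselect => Dw Bw; [left|right; case: pselect].
    move=> [[Dw Bw]|]; first by case: pselect.
    by case: pselect => // BN nD; case: pselect.
  apply: measurableU; first exact: mx.
  by case: pselect => // _; exact: measurableC.
move=> w; case: pselect => [Dw|nD]; first exact: xA.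
by move=> y Ay; apply: nD; apply/DA; exists y.
Qed.

(** * Estimators that prefer zeros near a given point *)

Section localized_estimator.
Context d (T : measurableType d) (R : realType) (p : nat) (P : probability T R).
Variables (Theta : set 'rV[R]_p) (F : set (set T)) (G : 'rV[R]_p -> T -> 'rV[R]_p).
Variable x0 : 'rV[R]_p.
Hypothesis F_sub : complete_sub_sigma_field P F.
Hypothesis Theta_borel : measurable (Theta : set (borelRV R p)).
Hypothesis G_ef : estimating_function Theta F G.

Definition zero_within (j : nat) : set T :=
  [set w | exists x, [/\ Theta x, G x w = 0 & `|x - x0| <= j.+1%:R^-1]].

Lemma closed_norm_le (c : 'rV[R]_p) (r : R) :
  closed [set x : 'rV[R]_p | `|x - c| <= r].
Proof.
rewrite (_ : [set _ | _] = closed_ball_ Num.norm c r); first exact: closed_closed_ball_.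
by apply/seteqP; split=> v; rewrite /closed_ball_ /= distrC.
Qed.

Lemma borel_closed (C : set 'rV[R]_p) : closed C -> measurable (C : set (borelRV R p)).
Proof.
move=> cC; rewrite -[C]setCK; apply: measurableC.
by apply: sub_sigma_algebra; exact: closed_openC.
Qed.

Lemma zero_selection (K : set 'rV[R]_p) : measurable (K : set (borelRV R p)) ->
  exists s : T -> option 'rV[R]_p, measurable_delta F s /\
    forall w, if s w is Some x then [/\ Theta x, G x w = 0 & K x]
              else forall x, ~ [/\ Theta x, G x w = 0 & K x].
Proof.
move=> mK; have [sF _ _] := F_sub.
pose A : set (borelRV R p * g_sigma_algebraType F) :=
  ((Theta `*` [set: T]) `&` (fun z => G z.1 z.2) @^-1` [set 0]) `&` (K `*` [set: T]).
have mT : measurable ([set: T] : set (g_sigma_algebraType F)) by exact: measurableT.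
have mA : measurable A.
  apply: measurableI; last exact: measurableX.
  apply: G_ef; first exact: measurableX.
  apply: borel_closed.
  rewrite (_ : [set 0] = [set x | `|x - 0| <= 0]); first exact: closed_norm_le.
  by apply/seteqP; split=> x /=; rewrite subr0 normr_le0; move/eqP.
have [s [ms sP]] := delta_selection F_sub mA.
exists s; split=> // w; have := sP w; case: (s w) => [x [[[Tx _] Gx] [Kx _]]|h x [Tx Gx Kx]].
  by split.
by apply: (h x).
Qed.

Lemma measurable_zero_within j : F (zero_within j).
Proof.
have [s [ms sP]] := zero_selection (borel_closed (@closed_norm_le x0 j.+1%:R^-1)).
have -> : zero_within j = s @^-1` [set y | y <> None].
  apply/seteqP; split=> w; have := sP w; rewrite /=; case: (s w) => [x|] //.
    by move=> h [x /h].
  by move=> h _; exists x.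
apply: ms; rewrite (_ : _ @^-1` _ = setT); first exact: measurableT.
by apply/seteqP; split.
Qed.

Lemma measurable_delta_override (h s : T -> option 'rV[R]_p) :
  measurable_delta F h -> measurable_delta F s ->
  measurable_delta F (fun w => if s w is Some x then Some x else h w).
Proof.
move=> mh ms B mB; have [sF _ _] := F_sub.
have mN : F (s @^-1` [set None]).
  apply: ms; rewrite (_ : _ @^-1` _ = set0); first exact: measurable0.
  by apply/seteqP; split.
have mS : F (s @^-1` (B `\` [set None])).
  apply: ms; rewrite (_ : _ @^-1` _ = Some @^-1` B)//.
  by apply/seteqP; split=> y /= => [[]|By]//.
have mH : F (h @^-1` B) by exact: mh.
rewrite -(sub_measurableE sF) in mN mS mH *.
have -> : (fun w => if s w is Some x then Some x else h w) @^-1` B =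
    (s @^-1` (B `\` [set None])) `|` (s @^-1` [set None] `&` h @^-1` B).
  apply/seteqP; split=> w /=; case: (s w) => [x|] Bw.
  - by left.
  - by right.
  - by case: Bw => [[]|[]].
  - by case: Bw => [[]|[]].
by apply: measurableU => //; exact: measurableI.
Qed.

(* [h] looks for a zero in the smallest of the first [N] balls that has one. *)
Lemma localized_estimator (N : nat) : exists h : T -> option 'rV[R]_p,
  estimator Theta F G h /\
  forall j w, (j < N)%N -> zero_within j w ->
    exists x, h w = Some x /\ `|x - x0| <= j.+1%:R^-1.
Proof.
suff [h [mh hS hN hj]] : exists h, [/\ measurable_delta F h,
    forall w x, h w = Some x -> Theta x /\ G x w = 0,
    forall w, h w = None -> ~ zero_event Theta G w &
    forall j w, (j < N)%N -> zero_within j w ->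
      exists x, h w = Some x /\ `|x - x0| <= j.+1%:R^-1].
  exists h; split=> //; split=> // w.
    case hw : (h w) => [x|]; last by move/hN : hw.
    by have [Tx Gx] := hS _ _ hw; exists x.
  case hw : (h w) => [x|//] nw; exfalso; apply: nw.
  by have [Tx Gx] := hS _ _ hw; exists x.
elim: N => [|N [h [mh hS hN hj]]].
  (* With no ball to search, any measurable choice among all zeros in [Theta] will do. *)
  have [s [ms sP]] := zero_selection (measurableT : measurable (setT : set (borelRV R p))).
  exists s; split=> // [w x sw|w sw].
    by have := sP w; rewrite sw => -[].
  by have := sP w; rewrite sw => h [x Tx Gx]; apply: (h x).
have [s [ms sP]] := zero_selection (borel_closed (@closed_norm_le x0 N.+1%:R^-1)).
(* The balls shrink with their index, so a zero in ball [N] meets the bounds of all earlier balls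
   and may override [h]. *)
exists (fun w => if s w is Some x then Some x else h w); split.
- exact: measurable_delta_override.
- move=> w x; have := sP w; case: (s w) => [y [Ty Gy _] [<-]//|_]; exact: hS.
- by move=> w; case: (s w) => // /hN.
- move=> j w; rewrite ltnS leq_eqVlt => jN wj; have := sP w.
  case: (s w) => [y [_ _ yN]|nN].
    exists y; split=> //; apply: le_trans yN _.
    rewrite lef_pV2 ?posrE// ler_nat.
    by case/orP: jN => [/eqP->//|/ltnW].
  case/orP : jN => [/eqP jN|jN]; last exact: hj.
  by case: wj => x; rewrite jN => /nN.
Qed.

Lemma estimating_function_section x : Theta x ->
  measurable_fun [set: T] (G x : T -> borelRV R p).
Proof.
move=> Tx _ B mB; have [sF FT _] := F_sub; rewrite setTI; apply: FT.
rewrite -(sub_measurableE sF).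
have mT : measurable ([set: T] : set (g_sigma_algebraType F)) by exact: measurableT.
have mA := G_ef (measurableX Theta_borel mT) mB.
have := @pair1_measurable _ _ (borelRV R p) (g_sigma_algebraType F) x measurableT _ mA.
rewrite setTI; congr (measurable _); apply/seteqP; split=> w /=; first by case.
by move=> ?; split.
Qed.

End localized_estimator.

(** * Passing from the limit Jacobian to a nearby one *)

Section newton_step.
Context (R : realType) (p : nat).

(** By the triangle inequality the deviation splits in two. The part from moving [x] away from [x0]
    is controlled by the first clause of the good event; the part [e] by the inverse bound [k.+1]
    and the smallness of [e]. Each uses half of the allowance. *)
Lemma good_increment d (T : measurableType d) (J : 'rV[R]_p -> T -> 'M[R]_p) (f : 'rV[R]_p -> 'rV[R]_p)
    (x0 : 'rV[R]_p) (rad e : R) (k : nat) w :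
  good_event J x0 rad k w -> 0 <= e -> 4 * (p%:R * e) * k.+1%:R <= 1 ->
  forall x, `|x - x0| < rad -> `|jacobian f x - J x w| <= e ->
  forall v : 'rV[R]_p, 2 * (p%:R * `|jacobian f x - J x0 w| * `|v|) <= `|v *m J x0 w|.
Proof.
move=> [h1 h2] e0 ek x xr fe v.
set A := J x0 w in h1 h2 *; have vA := normr_ge0 (v *m A).
have a1 : `|jacobian f x - A| <= e + `|J x w - A|.
  rewrite (_ : _ - A = (jacobian f x - J x w) + (J x w - A)); last by rewrite addrA subrK.
  by apply: le_trans (ler_normD _ _) _; rewrite lerD2r.
have a2 : 4 * (p%:R * e * `|v|) <= `|v *m A|.
  apply: (@le_trans _ _ (4 * (p%:R * e) * (k.+1%:R * `|v *m A|))).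
    by rewrite mulrA ler_wpM2l// !mulr_ge0.
  by rewrite [leLHS]mulrA -[leRHS]mul1r ler_wpM2r.
have a3 := h1 x xr v.
apply: (@le_trans _ _ (2 * (p%:R * (e + `|J x w - A|) * `|v|))).
  by rewrite ler_wpM2l// ler_wpM2r// ler_wpM2l.
rewrite mulrDr mulrDl mulrDr; move: a2 a3.
set X := p%:R * e * _; set Y := p%:R * `|_| * _; set Z := `|_|.
by lra.
Qed.

End newton_step.

(** * Existence, consistency and eventual uniqueness *)

Theorem theorem2p5 (R : realType) (p : nat) (d : measure_display)
  (T : measurableType d) (P : probability T R)
  (P_complete : measure_is_complete P)
  (Theta : set 'rV[R]_p)
  (Theta_borel : measurable (Theta : set (borelRV R p)))
  (F : nat -> set (set T))
  (F_sub : forall n, complete_sub_sigma_field P (F n))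
  (Gn : nat -> 'rV[R]_p -> T -> 'rV[R]_p)
  (Gn_ef : forall n, estimating_function Theta (F n) (Gn n))
  (thetabar : 'rV[R]_p) (thetabar_int : interior Theta thetabar)
  (M : set 'rV[R]_p) (M_nbhs : open_nbhs thetabar M) (M_sub : M `<=` Theta)
  (G : 'rV[R]_p -> T -> 'rV[R]_p)
  (G_rand : forall theta, M theta ->
    measurable_fun [set: T] (G theta : T -> borelRV R p))
  (Gn_cvg : cvg_prob0 P (fun n w => (enorm (Gn n thetabar w))%:E))
  (G_zero : {ae P, forall w, G thetabar w = 0})
  (C1 : {ae P, forall w, C1_on M (fun theta => G theta w) /\
                         forall n, C1_on M (fun theta => Gn n theta w)})
  (J_cvg : cvg_prob0 P (fun n w =>
    ereal_sup [set (opnorm (jacobian (fun t => Gn n t w) theta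
                            - jacobian (fun t => G t w) theta))%:E
              | theta in M]))
  (J_inv : {ae P, forall w, jacobian (fun t => G t w) thetabar \in unitmx}) :
  exists h : nat -> T -> option 'rV[R]_p,
    [/\ forall n, estimator Theta (F n) (Gn n) (h n),
        weakly_consistent P thetabar h &
        forall h' : nat -> T -> option 'rV[R]_p,
          (forall n, estimator Theta (F n) (Gn n) (h' n)) ->
          weakly_consistent P thetabar h' ->
          P [set w | h n w <> h' n w] @[n --> \oo] --> (0%E : \bar R)].
Proof.
(* The almost sure regularity conditions are gathered on one measurable set of full probability. *)
have [D [mD D0 DP]] : exists D : set T, [/\ measurable D, P (~` D) = 0%E &
    forall w, D w -> [/\ C1_on M (G ^~ w), forall n, C1_on M (Gn n ^~ w) &
                     jacobian (G ^~ w) thetabar \in unitmx]].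
  have [N [mN N0 NP]] : {ae P, forall w, [/\ C1_on M (G ^~ w),
      forall n, C1_on M (Gn n ^~ w) & jacobian (G ^~ w) thetabar \in unitmx]}.
    by apply: filterS2 C1 J_inv => w [].
  exists (~` N); split; [exact: measurableC|by rewrite setCK|].
  by move=> w nN; apply: contrapT => nP; exact/nN/NP.
have oM : open M by case: M_nbhs.
have Mt : M thetabar by case: M_nbhs.
have openM x : M x -> open_nbhs x M by split.
pose JG x w := jacobian (G ^~ w) x.
pose JN n x w := jacobian (Gn n ^~ w) x.
have coord_meas (f : 'rV[R]_p -> T -> 'rV[R]_p) x :
    measurable_fun [set: T] (f x : T -> borelRV R p) ->
    forall j, measurable_fun D (fun w => f x w ord0 j).
  move=> mf j; apply: measurable_funTS.
  exact: (measurable_continuous_borelRV mf (@coord_continuous R 1 p ord0 j)).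
have JG_meas x : M x -> forall i j, measurable_fun D (fun w => JG x w i j).
  move=> Mx; apply: (measurable_jacobian (openM _ Mx)).
    by move=> y My; apply: coord_meas; exact: G_rand.
  by move=> w /DP[cG _ _]; case: (cG _ Mx).
have JN_meas n x : M x -> forall i j, measurable_fun D (fun w => JN n x w i j).
  move=> Mx; apply: (measurable_jacobian (openM _ Mx)).
    move=> y My; apply: coord_meas.
    exact: (estimating_function_section (F_sub n) Theta_borel (Gn_ef n) (M_sub _ My)).
  by move=> w /DP[_ cN _]; case: (cN n _ Mx).
have JN_cont n w : D w -> forall x, M x -> {for x, continuous (fun y => JN n y w)}.
  by move=> /DP[_ cN _] x Mx; case: (cN n _ Mx).
have JG_cont w : D w -> forall x, M x -> {for x, continuous (fun y => JG y w)}.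
  by move=> /DP[cG _ _] x Mx; case: (cG _ Mx).
have JG_unit w : D w -> JG thetabar w \in unitmx by case/DP.
pose X n (e : R) := [set w | (e%:E < ereal_sup
  [set (opnorm (JN n x w - JG x w))%:E | x in M])%E].
(* Off [D] nothing is known about the Jacobians, but that part is null and completeness of [P] makes
   it measurable. *)
have mX n e : 0 <= e -> measurable (X n e).
  move=> e0; rewrite -(setIT (X n e)) -(setUv D) setIUr; apply: measurableU.
    rewrite setIC; exact: (measurable_sup_opnorm_sub mD (JN_meas n) JG_meas
      (JN_cont n) JG_cont oM e0).
  apply: P_complete; exists (~` D).
  by split; [exact: measurableC|exact: D0|exact: subIsetr].
have /nbhs_ballP[r0 /= r00 r0M] : nbhs thetabar M by exact: open_nbhs_nbhs.
have r0M' x : `|x - thetabar| < r0 -> M x.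
  by move=> xr; apply: r0M; rewrite -ball_normE /= distrC.
pose Z k := ~` (D `&` good_event JG thetabar (r0 / k.+1%:R) k).
have rk k : r0 / k.+1%:R <= r0.
  by rewrite ler_pdivrMr// ler_peMr ?(ltW r00)// ler1n.
have mZ k : measurable (Z k).
  apply/measurableC/(measurable_good_event (M := M)) => // x xr.
  by apply: r0M'; exact: lt_le_trans (rk k).
have Z0 : P (Z k) @[k --> \oo] --> 0%E.
  exact: (good_event_cvg mD D0 M_nbhs JG_meas JG_cont JG_unit).
(* Halving puts the closed ball of radius [rad k] inside the open ball of the good event. *)
pose rad k := r0 / k.+1%:R / 2.
have rad0 k : 0 < rad k by rewrite !divr_gt0.
have radr k : rad k < r0 / k.+1%:R.
  by rewrite /rad ltr_pdivrMr// ltr_pMr ?divr_gt0// ltr1n.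
(* The tolerance allowed by [good_increment]; [p.+1] keeps the denominator positive for [p = 0]. *)
pose eps k : R := (4 * p.+1%:R * k.+1%:R)^-1.
have eps0 k : 0 < eps k by rewrite invr_gt0 !mulr_gt0.
have eps1 k : 4 * (p%:R * eps k) * k.+1%:R <= 1.
  rewrite (_ : _ * _ = (4 * p%:R * k.+1%:R) * eps k); last by ring.
  by rewrite /eps ler_pdivrMr ?mulr_gt0// mul1r ler_wpM2r// ler_wpM2l// ler_nat.
(* Outside two exceptional events, [Gn n] meets the hypotheses of both near-linear lemmas on a ball
   that does not depend on [n] or [w]. *)
have linear n k w : ~ Z k w -> ~ X n (eps k) w ->
    (forall x, `|x - thetabar| <= rad k -> differentiable (Gn n ^~ w) x /\
      forall v : 'rV[R]_p, 2 * (p%:R * `|JN n x w - JG thetabar w| * `|v|)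
        <= `|v *m JG thetabar w|) /\
    (forall v : 'rV[R]_p, `|v| <= k.+1%:R * `|v *m JG thetabar w|).
  move=> /contrapT[Dw gw] /negP; rewrite -leNgt => Xw.
  have [_ cN _] := DP w Dw.
  split; last by case: gw.
  move=> x xr; have xr' := le_lt_trans xr (radr k).
  have Mx : M x by apply: r0M'; exact: lt_le_trans (rk k).
  split; first by case: (cN n x Mx).
  apply: (good_increment gw (ltW (eps0 k)) (eps1 k) xr').
  apply: le_trans (norm_le_opnorm _) _; rewrite -lee_fin; apply: le_trans Xw.
  by apply: ereal_sup_ubound; exists x.
(* The extra point is at distance 1, so a bound below 1 excludes it. *)
have near_delta y (del : R) : del < 1 -> dist_delta y (Some thetabar) <= del ->
    exists2 x, y = Some x & `|x - thetabar| <= del.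
  case: y => [x|] /= d1 xd; last by move: (le_lt_trans xd d1); rewrite ltxx.
  by exists x => //; exact: le_trans (norm_le_enorm _) xd.
have FT n A : F n A -> measurable A by case: (F_sub n) => _ + _; exact.
(* The estimator at stage [n] searches [n] balls, so each fixed ball [j] is searched as soon as
   [j < n]. *)
have /choice[h hP] n := localized_estimator thetabar (F_sub n) Theta_borel (Gn_ef n) n.
have mW n j : measurable (zero_within Theta (Gn n) thetabar j).
  exact: (FT n _ (measurable_zero_within _ (F_sub n) Theta_borel (Gn_ef n) j)).
have mdist n (g : T -> option 'rV[R]_p) (e : R) : estimator Theta (F n) (Gn n) g ->
    measurable [set w | (e%:E < (dist_delta (g w) (Some thetabar))%:E)%E].
  move=> [mg _ _]; apply: (FT n).
  rewrite (_ : [set _ | _] = [set w | e < dist_delta (g w) (Some thetabar)]).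
    exact: (measurable_delta_ltr thetabar e mg).
  by apply/seteqP; split=> w; rewrite /= lte_fin.
have W0 j : P (~` zero_within Theta (Gn n) thetabar j) @[n --> \oo] --> 0%E.
  apply: (prob_cvg0_approx (Z := Z)) => // [n|k]; first exact: measurableC.
  (* The zero is found within [k.+1%:R * rho], which is made small enough both for near-linearity
     and for ball [j]. *)
  pose rho := Num.min (rad k) j.+1%:R^-1 / k.+1%:R.
  have rho0 : 0 < rho by rewrite divr_gt0// lt_min rad0 invr_gt0 ltr0n.
  have krho : k.+1%:R * rho = Num.min (rad k) j.+1%:R^-1.
    by rewrite /rho mulrC divfK.
  have rho20 : 0 < rho / 2 by rewrite divr_gt0.
  have mG n : measurable [set w | ((rho / 2)%:E < (enorm (Gn n thetabar w))%:E)%E].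
    rewrite (_ : [set _ | _] =
        [set: T] `&` [set w | rho / 2 < enorm (Gn n thetabar w)]); last first.
      by rewrite setTI; apply/seteqP; split=> w; rewrite /= lte_fin.
    apply: measurable_lt_set => //.
    apply: (measurable_continuous_borelRV (f := Gn n thetabar)); last first.
      exact: enorm_continuous.
    exact: (estimating_function_section (F_sub n) Theta_borel (Gn_ef n) (M_sub _ Mt)).
  exists (fun n => X n (eps k) `|`
    [set w | ((rho / 2)%:E < (enorm (Gn n thetabar w))%:E)%E]); split.
  - by move=> n; apply: measurableU => //; exact/mX/ltW.
  - apply: prob_cvg0U => //; first by move=> n; exact/mX/ltW.
      exact: J_cvg.
    exact: Gn_cvg.
  - move=> n w nW; apply: contrapT => /not_orP[nZ /not_orP[nX nG]]; apply: nW.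
    have [lin low] := linear n k w nZ nX.
    have [||x [xr x0]] := near_linear_zero lin low (ltW rho0) (ler0n _ _) _ _.
      by rewrite krho ge_min lexx.
      move/negP: nG; rewrite -leNgt lee_fin => nG.
      rewrite mulrC -ler_pdivlMr//; exact: le_trans (norm_le_enorm _) nG.
    rewrite krho le_min in xr; case/andP: xr => xr xj.
    exists x; split=> //; apply: M_sub; apply: r0M'.
    exact: le_lt_trans xr (lt_le_trans (radr k) (rk k)).
have hE n : estimator Theta (F n) (Gn n) (h n) by case: (hP n).
have hC : weakly_consistent P thetabar h.
  (* The division by [p.+1] pays for passing from the sup norm to the Euclidean norm. *)
  move=> e e0; have [j je] := natSinv_lt (divr_gt0 e0 (ltr0Sn R p)).
  apply: (prob_cvg0_sub (B := fun n => ~` zero_within Theta (Gn n) thetabar j)) => //.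
  + by move=> n; apply: (mdist n).
  + by move=> n; exact: measurableC.
  + exists j.+1 => // n /= jn w /=; rewrite lte_fin => ew Ww.
    have [_ /(_ j w jn Ww)[x [hx xj]]] := hP n.
    move: ew; rewrite hx /= ltNge => /negP; apply.
    apply: le_trans (enorm_le_norm _) _.
    apply: (@le_trans _ _ (p.+1%:R * j.+1%:R^-1)).
      by rewrite ler_pM// ler_nat.
    by move/ltW: je; rewrite ler_pdivlMr// mulrC.
exists h; split=> // h' h'E h'C.
have mneq n : measurable [set w | h n w <> h' n w].
  have [sF _ _] := F_sub n; have [[mh _ _] _] := hP n; have [mh' _ _] := h'E n.
  exact: (FT n _ (measurable_delta_neq sF mh mh')).
apply: (prob_cvg0_approx (Z := Z)) => // k.
(* The bound 1/2 excludes the extra point, and [rad k] keeps both estimators in the ball where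
   [Gn n] is injective. *)
pose del := Num.min (rad k) 2^-1.
have del0 : 0 < del by rewrite lt_min rad0 invr_gt0 ltr0n.
have del1 : del < 1 by rewrite gt_min invf_lt1// ltr1n orbT.
have delr : del <= rad k by rewrite ge_min lexx.
pose far (g : nat -> T -> option 'rV[R]_p) n :=
  [set w | (del%:E < (dist_delta (g n w) (Some thetabar))%:E)%E].
have mfar g n : (forall n, estimator Theta (F n) (Gn n) (g n)) -> measurable (far g n).
  by move=> gE; exact: (mdist n).
exists (fun n => X n (eps k) `|` (far h n `|` far h' n)); split.
+ move=> n; apply: measurableU; first exact/mX/ltW.
  by apply: measurableU; exact: mfar.
+ apply: prob_cvg0U; first by move=> n; exact/mX/ltW.
  * by move=> n; apply: measurableU; exact: mfar.
  * exact: J_cvg.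
  * by apply: prob_cvg0U; [move=> n; exact: mfar|move=> n; exact: mfar|exact: hC|exact: h'C].
+ move=> n w hh; apply: contrapT => /not_orP[nZ /not_orP[nX /not_orP[nh nh']]].
  apply: hh; have [lin low] := linear n k w nZ nX.
  move/negP: nh; rewrite -leNgt lee_fin => /(near_delta _ _ del1)[x hx xr].
  move/negP: nh'; rewrite -leNgt lee_fin => /(near_delta _ _ del1)[y hy yr].
  (* A value other than the extra point is taken only where a zero exists, and there it is a
     zero. *)
  have zeroE g z : estimator Theta (F n) (Gn n) g -> g w = Some z -> Gn n z w = 0.
    move=> [_ gz gN] gw; have [zw|/gN] := pselect (zero_event Theta (Gn n) w).
      by have [t [gt _ <-]] := gz w zw; congr (Gn n _ w); move: gt; rewrite gw => -[].
    by rewrite gw.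
  rewrite hx hy; congr Some; apply: (near_linear_inj lin low).
  * exact: le_trans delr.
  * exact: le_trans delr.
  * by rewrite (zeroE _ _ (hE n) hx) (zeroE _ _ (h'E n) hy).
Qed.
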